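(* For each $\epsilon>0$ there is a constant $C_\epsilon$ such that the following holds. Let $\Lambda\subset P^2$ be an arbitrary finite collection of points (no separation is assumed). Then there is $R_0=R_0(\Lambda)$, depending only on the geometry of $\Lambda$ and on its cardinality $|\Lambda|$, such that for each $R\ge R_0$, each ball $B_R\subset\mathbb{R}^3$ of radius $R$ and all complex coefficients $(a_\xi)_{\xi\in\Lambda}$, $$\Big(\frac{1}{|B_R|}\int_{B_R}\Big|\sum_{\xi\in\Lambda}a_\xi e(\xi\cdot x)\Big|^{4}dx\Big)^{1/4}\le C_\epsilon\,|\Lambda|^{\epsilon}\Big(\sum_{\xi\in\Lambda}|a_\xi|^2\Big)^{1/2}.$$
   Context: $e(a)=e^{2\pi i a}$. $P^2=\{(\xi_1,\xi_2,\xi_1^2+\xi_2^2)\in\mathbb{R}^3:\ |\xi_1|,|\xi_2|\le 1/2\}$. $|B_R|$ is the Lebesgue measure of $B_R$ and $|\Lambda|$ the cardinality of $\Lambda$. The constant $C_\epsilon$ does not depend on $\Lambda$, $R$, $B_R$ or the coefficients. *)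

(* Defs.v *)
From HB Require Import structures.
From mathcomp Require Export all_boot all_order all_algebra finmap.
From mathcomp Require Export complex.
From mathcomp Require Export all_classical all_reals all_analysis.

Set Implicit Arguments.
Unset Strict Implicit.
Unset Printing Implicit Defensive.

Import Order.TTheory GRing.Theory Num.Theory.

Local Open Scope classical_set_scope.
Local Open Scope ring_scope.
Local Open Scope complex_scope.

(* The library equips products of normed spaces with the sup norm, so the
   Euclidean ball of R^3 is spelled out on the coordinates
   x.1.1, x.1.2, x.2 of x : R * R * R. *)
Definition dot3 (R : realType) (x y : R * R * R) : R :=
  x.1.1 * y.1.1 + x.1.2 * y.1.2 + x.2 * y.2.

Definition eball3 (R : realType) (c : R * R * R) (r : R) : set (R * R * R) :=
  [set x | Num.sqrt (dot3 (x - c) (x - c)) < r].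

Definition lebesgue3 (R : realType) :
    {measure set (measurableTypeR R * measurableTypeR R * measurableTypeR R)
      -> \bar R} :=
  ((@lebesgue_measure R \x @lebesgue_measure R) \x @lebesgue_measure R)%E.

Definition paraboloid (R : realType) : set (R * R * R) :=
  [set x | [/\ `|x.1.1| <= 2^-1, `|x.1.2| <= 2^-1
             & x.2 = x.1.1 ^+ 2 + x.1.2 ^+ 2]].

Definition e2pi (R : realType) (t : R) : R[i] :=
  cos (2 * pi * t) +i* sin (2 * pi * t).

Definition expsum (R : realType) (L : {fset R * R * R})
    (a : R * R * R -> R[i]) (x : R * R * R) : R[i] :=
  \sum_(xi <- L) a xi * e2pi (dot3 xi x).

(* Main.v *)
(** The average over a ball is dominated by the average over the circumscribed
    cube.  There the fourth power expands into frequencies p + q - r - s, and for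
    large radius only the frequency 0 survives, so the problem is to bound the
    number of solutions of p + q = r + s in Lambda.  On the paraboloid such a
    solution projects to a rectangle of the plane, hence to a right angle spanned
    by three points.  Following Pach and Sharir, N points of the plane span
    O(N^2 log N) right angles: charge a right angle to its longer leg (the one
    whose line carries more points) and bound the number of rich lines by the
    Szemeredi-Trotter theorem, proved here through the crossing inequality for
    straight-line drawings.  Arbitrary coefficients are reduced to coefficients of
    comparable size by splitting dyadically into O(log N) levels, and powers of
    log N are absorbed in N^eps. *)

From HB Require Import structures.
Require Import Defs.
From mathcomp Require Import measurable_realfun.
From mathcomp Require Import lra zify ring.

Import Order.TTheory GRing.Theory Num.Theory numFieldNormedType.Exports.

Local Open Scope ring_scope.

(** * Straight-line drawings without crossings *)

(** Planarity is not treated topologically: edges are graphs of affine functions over intervals, and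
    the linear bound for drawings without crossings comes from charging edges injectively to
    vertices instead of Euler's formula. Cubes replace balls because there the integrals factor into
    one-dimensional ones; the volumes are comparable, so only a constant is lost. Comparable
    coefficients are needed because the energy bound yields [A ^+ 4 * N ^+ 2 * log N] for [N]
    coefficients of size at most [A], which the squared sum of squares controls when all of them are
    within a constant factor of [A]. The dyadic levels depend on the coefficients while the radius
    threshold must not: it is fixed through the quadruples of the whole of [L], which include those
    of every level. The fourth moment loses four logarithms, three of them by the splitting; the
    fourth root leaves one. *)

Lemma leq_card_inj_in (S T : finType) (A : {set S}) (B : {set T}) (f : S -> T) :
  {in A, forall x, f x \in B} -> {in A &, injective f} -> (#|A| <= #|B|)%N.
Proof.
move=> fAB injf; rewrite -(card_in_imset injf).
by apply/subset_leq_card/fintype.subsetP => _ /imsetP[x /fAB + ->].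
Qed.

Section Segments.
Variables (R : realFieldType) (T : finType) (X Y : T -> R).
Hypothesis injX : injective X.

Definition slope (e : T * T) : R := (Y e.2 - Y e.1) / (X e.2 - X e.1).

Definition height (e : T * T) (x : R) : R := Y e.1 + slope e * (x - X e.1).

(** Only interior abscissas count: edges that merely share an endpoint do not cross, whereas
    distinct edges overlapping along a segment do. *)
Definition crossing (e f : T * T) : Prop :=
  e <> f /\ exists x, [/\ X e.1 < x < X e.2, X f.1 < x < X f.2
                       & height e x = height f x].

Definition is_edge (V : {set T}) (e : T * T) : Prop :=
  [/\ e.1 \in V, e.2 \in V, X e.1 < X e.2
    & forall v, v \in V -> X e.1 < X v < X e.2 -> height e (X v) <> Y v].

Lemma height_left e : height e (X e.1) = Y e.1.
Proof. by rewrite /height subrr mulr0 addr0. Qed.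

Lemma height_right e : X e.1 < X e.2 -> height e (X e.2) = Y e.2.
Proof.
by move=> lt12; rewrite /height /slope divfK ?subr_eq0 ?gt_eqF// subrKC.
Qed.

Lemma heightB e x y : height e x - height e y = slope e * (x - y).
Proof. by rewrite /height; ring. Qed.

Lemma affine_zero (a b c x : R) : c < x -> a + b * c < 0 -> 0 < a + b * x ->
  exists2 z, c < z < x & a + b * z = 0.
Proof.
move=> cx nc px.
have bgt0 : 0 < b by nra.
exists (- a / b); last by field; lra.
by rewrite ltr_pdivlMr // ltr_pdivrMr //; lra.
Qed.

Lemma height_zero e f c x : c < x -> height e c < height f c ->
  height f x < height e x -> exists2 z, c < z < x & height e z = height f z.
Proof.
move=> cx h1 h2.
have [] := @affine_zero (height e 0 - height f 0) (slope e - slope f) c x cx.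
- have := heightB e c 0; have := heightB f c 0; rewrite subr0; lra.
- have := heightB e x 0; have := heightB f x 0; rewrite subr0; lra.
move=> z zcx hz; exists z => //.
have := heightB e z 0; have := heightB f z 0; rewrite subr0; lra.
Qed.

Lemma same_left_height e f x : e.1 = f.1 -> X e.1 < x ->
  (slope e < slope f) = (height e x < height f x).
Proof.
move=> ef ltx; rewrite /height -ef ltrD2l ltr_pM2r //; lra.
Qed.

Section Planar.
Variables (V : {set T}) (E : {set T * T}).
Hypothesis edgeE : forall e, e \in E -> is_edge V e.
Hypothesis planarE : forall e f, e \in E -> f \in E -> ~ crossing e f.

Lemma planar_slope_inj e f : e \in E -> f \in E -> e.1 = f.1 ->
  slope e = slope f -> e = f.
Proof.
move=> eE fE ef sef; apply: contrapT => nef; apply: (planarE _ _ eE fE).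
split=> //; have [_ _ le _] := edgeE _ eE; have [_ _ lf _] := edgeE _ fE.
rewrite -ef in lf.
exists ((X e.1 + Num.min (X e.2) (X f.2)) / 2).
split; [|rewrite -ef|].
- by case: (leP (X e.2) (X f.2)) => ?; apply/andP; split; lra.
- by case: (leP (X e.2) (X f.2)) => ?; apply/andP; split; lra.
by rewrite /height ef sef.
Qed.

(* [v] is the leftmost vertex of the wedge to the right of [e.1] that lies
   between [e] and the next steeper edge [e'] leaving [e.1]; the wedge is
   crossed by no edge to the left of [v]. *)
Definition wedge_end (e e' : T * T) (v : T) : Prop :=
  [/\ [/\ e' \in E, e'.1 = e.1 & slope e < slope e'],
      (forall f, f \in E -> f.1 = e.1 -> ~ (slope e < slope f < slope e')),
      [/\ v \in V, X e.1 < X v, X v <= X e.2 & X v <= X e'.2],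
      height e (X v) <= Y v <= height e' (X v)
    & forall z, z \in V -> X e.1 < X z < X v ->
        ~ (height e (X z) <= Y z <= height e' (X z))].

(** The wedge contains a vertex because the right endpoint of whichever of [e] and [e'] stops first
    lies in it. *)
Lemma wedge_endP e f : e \in E -> f \in E -> f.1 = e.1 -> slope e < slope f ->
  exists e' v, wedge_end e e' v.
Proof.
move=> eE fE fe sef.
pose Q g := [&& g \in E, g.1 == e.1 & slope e < slope g].
have Qf : Q f by rewrite /Q fE fe eqxx.
case: (arg_minP slope Qf) => e' /and3P[e'E /eqP e'1 see'] mine'.
have [_ e2V le _] := edgeE _ eE; have [_ e'2V le' _] := edgeE _ e'E.
pose W v := [&& v \in V, X e.1 < X v, X v <= X e.2, X v <= X e'.2
             & height e (X v) <= Y v <= height e' (X v)].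
have [v0 Wv0] : exists v, W v.
  case: (leP (X e.2) (X e'.2)) => le2.
    exists e.2; rewrite /W e2V le lexx le2 /= height_right // lexx /=.
    rewrite -[leLHS]height_right // ltW // -same_left_height //.
  exists e'.2; rewrite /W e'2V -{1}e'1 le' lexx (ltW le2) /=.
  rewrite [X in _ <= _ <= X]height_right // lexx andbT.
  by rewrite -[leRHS]height_right // ltW // -same_left_height // -?e'1.
case: (arg_minP X Wv0) => v /and5P[vV lv lv2 lv2' hv] minv.
exists e', v; split=> //.
  move=> g gE ge /andP[s1 s2].
  by have := mine' g; rewrite /Q gE ge eqxx s1 => /(_ isT); lra.
move=> z zV /andP[lz zv] hz.
have := minv z; rewrite /W zV lz hz (le_trans (ltW zv) lv2).
by rewrite (le_trans (ltW zv) lv2') => /(_ isT); lra.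
Qed.

(** Follow [g] from [x] to the left. It cannot leave the wedge through [e] or [e'] without a
    crossing, cannot start inside it by minimality of [v], cannot pass through the apex, which is a
    vertex, and cannot start there because [e] and [e'] have consecutive slopes. *)
Lemma wedge_empty e e' v g x : e \in E -> wedge_end e e' v -> g \in E ->
  X e.1 < x -> X g.1 < x -> x <= X v -> x <= X g.2 ->
  height e x < height g x -> height g x < height e' x -> False.
Proof.
move=> eE [[e'E e'1 see'] cons [vV lv lv2 lv2'] hv minv] gE lex lgx xv xg h1 h2.
have [g1V g2V lg ng] := edgeE _ gE.
have [e1V _ le _] := edgeE _ eE.
pose c := Num.max (X e.1) (X g.1).
have cx : c < x by rewrite /c gt_max lex lgx.
have ec : X e.1 <= c by rewrite /c le_max lexx.
have gc : X g.1 <= c by rewrite /c le_max lexx orbT.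
case: (ltP (height g c) (height e c)) => k1.
  have [z /andP[z1 z2] hz] := height_zero _ _ _ _ cx k1 h1.
  apply: (planarE _ _ gE eE); split; first by move=> ge; move: h1; rewrite ge ltxx.
  by exists z; split=> //; apply/andP; split; lra.
case: (ltP (height e' c) (height g c)) => k2.
  have [z /andP[z1 z2] hz] := height_zero _ _ _ _ cx k2 h2.
  apply: (planarE _ _ e'E gE); split; first by move=> ge; move: h2; rewrite ge ltxx.
  by exists z; split=> //; rewrite ?e'1; apply/andP; split; lra.
case: (ltP (X e.1) (X g.1)) => k3.
  have cg : c = X g.1 by rewrite /c; apply/max_idPr; exact: ltW.
  apply: (minv g.1) => //; first by apply/andP; split; lra.
  by move: k1 k2; rewrite cg height_left => -> ->.
have ce : c = X e.1 by rewrite /c; apply/max_idPl.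
have he : height g (X e.1) = Y e.1.
  have he' : height e' (X e.1) = Y e.1 by rewrite -e'1 height_left.
  by move: k1 k2; rewrite ce height_left he'; lra.
case: (ltP (X g.1) (X e.1)) => k4.
  by apply: (ng e.1) => //; apply/andP; split; lra.
have ge1 : g.1 = e.1 by apply: injX; lra.
apply: (cons g) => //; apply/andP; split.
  by rewrite (@same_left_height _ _ x) // ge1.
by rewrite (@same_left_height _ _ x) // ?ge1 // e'1.
Qed.

(** Both edges pass strictly below [v]. If their heights at [X v] differ, the upper one enters the
    wedge of the lower one; otherwise they cross there. *)
Lemma wedge_end_inj_above e1 e1' e2 e2' v : e1 \in E -> e2 \in E ->
  wedge_end e1 e1' v -> wedge_end e2 e2' v -> e1.2 <> v -> e2.2 <> v -> e1 = e2.
Proof.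
wlog le12 : e1 e1' e2 e2' / height e2 (X v) <= height e1 (X v).
  move=> wl E1 E2 w1 w2 n1 n2.
  case: (leP (height e2 (X v)) (height e1 (X v))) => h; first exact: (wl e1 e1' e2 e2').
  by apply/esym/(wl e2 e2' e1 e1') => //; exact: ltW.
move=> E1 E2 w1 w2 n1 n2.
have strict e e' : e \in E -> wedge_end e e' v -> e.2 <> v ->
    [/\ X e.1 < X v, X v < X e.2 & height e (X v) < Y v].
  move=> eE [_ _ [vV lv lv2 _] /andP[h _] _] nv.
  have lv2s : X v < X e.2.
    by rewrite lt_neqAle lv2 andbT; apply/eqP => /injX/esym.
  have [_ _ _ /(_ v vV)] := edgeE _ eE; rewrite lv lv2s => /(_ isT)/eqP ne.
  by split=> //; rewrite lt_neqAle ne.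
have [a1 b1 h1] := strict _ _ E1 w1 n1; have [a2 b2 h2] := strict _ _ E2 w2 n2.
apply: contrapT => n12.
case: (ltP (height e2 (X v)) (height e1 (X v))) => h12.
  have [_ _ _ /andP[_ top] _] := w2.
  apply: (wedge_empty e2 e2' v e1 (X v)) => //; lra.
apply: (planarE _ _ E1 E2); split=> //.
by exists (X v); rewrite a1 b1 a2 b2; split=> //; lra.
Qed.

(** Slightly to the left of the common right endpoint [v], the steeper edge runs below the other
    one, which therefore lies inside its wedge. *)
Lemma wedge_end_inj_on e1 e1' e2 e2' v : e1 \in E -> e2 \in E ->
  wedge_end e1 e1' v -> wedge_end e2 e2' v -> e1.2 = v -> e2.2 = v -> e1 = e2.
Proof.
wlog le12 : e1 e1' e2 e2' / slope e1 <= slope e2.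
  move=> wl E1 E2 w1 w2 n1 n2.
  case: (leP (slope e1) (slope e2)) => h; first exact: (wl e1 e1' e2 e2').
  by apply/esym/(wl e2 e2' e1 e1') => //; exact: ltW.
move=> E1 E2 w1 w2 n1 n2; apply: contrapT => n12.
have [_ _ l1 _] := edgeE _ E1; have [_ _ l2 _] := edgeE _ E2.
have [[e2'E e2'1 s2] _ [_ a2 _ _] _ _] := w2.
have hv1 : height e1 (X v) = Y v by rewrite -n1 height_right.
have hv2 : height e2 (X v) = Y v by rewrite -n2 height_right.
have hv2' : Y v < height e2' (X v).
  by rewrite -hv2 -same_left_height.
rewrite n1 in l1; rewrite n2 in l2.
pose c := Num.max (X e1.1) (X e2.1).
have cv : c < X v by rewrite /c gt_max l1 l2.
have c1 : X e1.1 <= c by rewrite /c le_max lexx.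
have c2 : X e2.1 <= c by rewrite /c le_max lexx orbT.
pose d := slope e2' - slope e1.
have [x cx hx] : exists2 x, c < x < X v & height e1 x < height e2' x.
  pose D := height e2' (X v) - Y v.
  have D0 : 0 < D by rewrite subr_gt0.
  (* Within distance [t] of [v] the gap [D] closes by at most [D / 2]; the [+ 1] covers equal
     slopes. *)
  pose t := D / (2 * (`|d| + 1)).
  have d0 : 0 < `|d| + 1 by rewrite ltr_wpDl.
  have t0 : 0 < t by rewrite divr_gt0 // mulr_gt0.
  have td : t * (`|d| + 1) = D / 2 by rewrite /t; field; lra.
  exists (Num.max ((c + X v) / 2) (X v - t)).
    apply/andP; split; first by rewrite lt_max; apply/orP; left; lra.
    by rewrite gt_max; apply/andP; split; lra.
  set x := Num.max _ _.
  have x1 : X v - t <= x by rewrite /x le_max lexx orbT.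
  have x2 : x <= X v by rewrite /x ge_max; apply/andP; split; lra.
  have := heightB e2' (X v) x; have := heightB e1 (X v) x.
  have dn : d <= `|d| by exact: ler_norm.
  have dx : d * (X v - x) <= (`|d| + 1) * t.
    apply: (@le_trans _ _ ((`|d| + 1) * (X v - x))).
      by apply: ler_wpM2r; lra.
    by apply: ler_wpM2l; lra.
  rewrite /d in dx dn; rewrite hv1 /D in td *.
  move: dx; rewrite mulrBl mulrC -/d; lra.
have /andP[cx1 cx2] := cx.
have s12 : slope e1 < slope e2.
  rewrite lt_neqAle le12 andbT; apply/eqP => s12.
  apply: (planarE _ _ E1 E2); split=> //; exists x; rewrite n1 n2.
  split; [by apply/andP; split; lra | by apply/andP; split; lra |].
  have := heightB e1 (X v) x; have := heightB e2 (X v) x.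
  by rewrite hv1 hv2 s12; lra.
apply: (wedge_empty e2 e2' v e1 x) => //; rewrite ?n1; try lra.
have := heightB e1 (X v) x; have := heightB e2 (X v) x.
rewrite hv1 hv2.
have : slope e1 * (X v - x) < slope e2 * (X v - x) by rewrite ltr_pM2r // subr_gt0.
lra.
Qed.

(** Three classes are charged injectively: the steepest edge leaving a vertex, to that vertex; the
    edges that end at their wedge end, and those that pass below it, to the wedge end. *)
Lemma planar_bound : (#|E| <= 3 * #|V|)%N.
Proof.
pose nontop (e : T * T) := `[< exists e' v, wedge_end e e' v >].
pose g (e : T * T) : T := xget e.1 [set v | exists e', wedge_end e e' v]%classic.
have gP e : nontop e -> exists e', wedge_end e e' (g e).
  move=> /asboolP[e' [v w]]; rewrite /g; case: xgetP => [z _ //|/(_ v) []].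
  by exists e'.
pose E1 := [set e in E | ~~ nontop e].
pose E2 := [set e in E | nontop e && (e.2 == g e)].
pose E3 := [set e in E | nontop e && (e.2 != g e)].
have -> : E = E1 :|: E2 :|: E3.
  apply/setP => e; rewrite !inE; case: (e \in E) => //=.
  by case: (nontop e) => //=; case: (_ == _).
have b1 : (#|E1| <= #|V|)%N.
  apply: (@leq_card_inj_in _ _ _ _ fst); first by move=> e; rewrite inE => /andP[/edgeE[]].
  move=> e f; rewrite !inE => /andP[eE ne] /andP[fE nf] ef.
  case: (ltgtP (slope e) (slope f)) => s.
  - case/negP: ne; apply/asboolP; exact: (wedge_endP e f).
  - case/negP: nf; apply/asboolP; exact: (wedge_endP f e).
  - exact: planar_slope_inj.
have b2 : (#|E2| <= #|V|)%N.
  apply: (@leq_card_inj_in _ _ _ _ g).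
    by move=> e; rewrite inE => /and3P[eE /gP[e' []]] _ _ [].
  move=> e f; rewrite !inE => /and3P[eE /gP[e' we] /eqP ge].
  move=> /and3P[fE /gP[f' wf] /eqP gf] gef.
  by rewrite -gef in wf gf; apply: (wedge_end_inj_on e e' f f' (g e)).
have b3 : (#|E3| <= #|V|)%N.
  apply: (@leq_card_inj_in _ _ _ _ g).
    by move=> e; rewrite inE => /and3P[eE /gP[e' []]] _ _ [].
  move=> e f; rewrite !inE => /and3P[eE /gP[e' we] /eqP ge].
  move=> /and3P[fE /gP[f' wf] /eqP gf] gef.
  by rewrite -gef in wf gf; apply: (wedge_end_inj_above e e' f f' (g e)).
apply: (leq_trans (leq_card_setU _ _)).
rewrite mulSn mulSn mul1n addnA leq_add //.
by apply: (leq_trans (leq_card_setU _ _)); rewrite leq_add.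
Qed.

End Planar.
End Segments.

(** * The crossing inequality *)

(** The zero set of a uniform function to ['I_q.+1] is a random subset keeping each element with
    probability [1 / q.+1]. It contains [A] with that probability to the power [#|A|]; the product
    form avoids division. *)
Lemma card_ffun_vanishing (T : finType) (q : nat) (A : {set T}) :
  (#|[set f : {ffun T -> 'I_q.+1} | [forall x in A, f x == ord0]]| * q.+1 ^ #|A|
   = q.+1 ^ #|T|)%N.
Proof.
pose F x : pred 'I_q.+1 := if x \in A then pred1 ord0 else predT.
have -> : #|[set f : {ffun T -> 'I_q.+1} | [forall x in A, f x == ord0]]|
          = #|family F|.
  apply: eq_card => f; rewrite inE; apply/forallP/familyP => h x; have := h x.
    by rewrite /F; case: (x \in A) => //= /eqP->; rewrite inE.
  by rewrite /F; case: (x \in A) => //=; rewrite inE.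
rewrite card_family foldrE big_map big_enum /=.
have -> : (q.+1 ^ #|A| = \prod_x (if x \in A then q.+1 else 1))%N.
  by rewrite -big_mkcond prod_nat_const.
have -> : (q.+1 ^ #|T| = \prod_(x : T) q.+1)%N by rewrite prod_nat_const.
rewrite -big_split /=; apply: eq_bigr => x _.
by rewrite /F; case: (x \in A); rewrite ?card1 ?mul1n // cardT size_enum_ord muln1.
Qed.

(** Linearity of expectation for the number of surviving objects, each resting on [d] elements. *)
Lemma sum_card_vanishing (S T : finType) (q d : nat) (A : {set S})
    (D : S -> {set T}) : {in A, forall x, #|D x| = d} ->
  ((\sum_(f : {ffun T -> 'I_q.+1}) #|[set x in A | [forall y in D x, f y == ord0]]|)
     * q.+1 ^ d = #|A| * q.+1 ^ #|T|)%N.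
Proof.
move=> cD.
under eq_bigr => f _.
  rewrite -sum1_card (eq_bigl (fun x => (x \in A) && [forall y in D x, f y == ord0]));
    last by move=> x; rewrite inE.
  rewrite big_mkcondr /=. over.
rewrite exchange_big /= big_distrl /= -sum_nat_const.
apply: eq_bigr => x xA; rewrite -(card_ffun_vanishing _ q (D x)) (cD _ xA).
congr (_ * _)%N; rewrite -sum1_card [RHS]big_mkcond /=.
by apply: eq_bigr => f _; rewrite inE.
Qed.

Section CrossingLemma.
Variables (R : realFieldType) (T : finType) (X Y : T -> R).
Hypothesis injX : injective X.
Local Notation height := (height R T X Y).
Local Notation slope := (slope R T X Y).
Local Notation crossing := (crossing R T X Y).
Local Notation is_edge := (is_edge R T X Y).

Definition crossings (E : {set T * T}) : {set (T * T) * (T * T)} :=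
  [set p | [&& p.1 \in E, p.2 \in E & `[< crossing p.1 p.2 >]]].

(** Deleting all edges that take part in a crossing leaves a planar drawing, and each deleted edge
    is the first component of some ordered pair in [crossings E]. *)
Lemma planar_defect (V : {set T}) (E : {set T * T}) :
  (forall e, e \in E -> is_edge V e) -> (#|E| <= 3 * #|V| + #|crossings E|)%N.
Proof.
move=> edgeE.
pose E' := [set e in E | ~~ [exists f in E, `[< crossing e f >]]].
have hE' : (#|E'| <= 3 * #|V|)%N.
  apply: (planar_bound _ _ X Y) => //.
    by move=> e; rewrite inE => /andP[/edgeE].
  move=> e f; rewrite !inE => /andP[_ /existsPn ne] /andP[fE _] cef.
  by have := ne f; rewrite fE /= => /asboolP.
have hD : (#|E :\: E'| <= #|crossings E|)%N.
  apply: leq_trans (leq_imset_card fst _).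
  apply/subset_leq_card/fintype.subsetP => e; rewrite !inE.
  move=> /andP[+ eE]; rewrite eE /= negbK => /existsP[f /andP[fE c]].
  by apply/imsetP; exists (e, f); rewrite // inE /= eE fE.
rewrite -(cardsID E' E); apply: leq_add => //; apply: leq_trans hE'.
exact/subset_leq_card/subsetIr.
Qed.

(** This makes a crossing survive the sampling with a fourth-power probability. Edges with a common
    left or right endpoint that also meet inside lie on one line, so they coincide or one has an
    endpoint of the other in its interior, which [is_edge] forbids. *)
Lemma crossing_endpoints (V : {set T}) e f : is_edge V e -> is_edge V f ->
  crossing e f -> #|[set e.1; e.2; f.1; f.2]| = 4%N.
Proof.
move=> [e1V e2V le he] [f1V f2V lf hf] [nef [x [/andP[ex1 ex2] /andP[fx1 fx2] hx]]].
have same z : X z <> x -> height e (X z) = Y z -> height f (X z) = Y z ->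
    forall t, height e t = height f t.
  move=> zx h1 h2 t.
  have s : slope e = slope f.
    have := heightB _ _ X Y e (X z) x; have := heightB _ _ X Y f (X z) x.
    rewrite h1 h2 hx => -> /mulIf inj; apply/esym/inj.
    by rewrite subr_eq0; apply/eqP.
  have := heightB _ _ X Y e t x; have := heightB _ _ X Y f t x.
  rewrite s hx; lra.
have he1 := height_left _ _ X Y e; have he2 := height_right _ _ X Y e le.
have hf1 := height_left _ _ X Y f; have hf2 := height_right _ _ X Y f lf.
have n11 : e.1 != f.1.
  apply/eqP => E; have all : forall t, height e t = height f t.
    by apply: (same e.1); [lra|done|rewrite E].
  have [l|l|/injX E2] := ltgtP (X e.2) (X f.2).
  - by apply: (hf e.2) => //; rewrite -?all // l -E le.
  - by apply: (he f.2) => //; rewrite ?all // l E lf.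
  - by apply: nef; rewrite (surjective_pairing e) (surjective_pairing f) E E2.
have n22 : e.2 != f.2.
  apply/eqP => E; have all : forall t, height e t = height f t.
    by apply: (same e.2); [lra|done|rewrite E].
  have [l|l|/injX E2] := ltgtP (X e.1) (X f.1).
  - by apply: (he f.1) => //; rewrite ?all // l E lf.
  - by apply: (hf e.1) => //; rewrite -?all // l -E le.
  - by apply: nef; rewrite (surjective_pairing e) (surjective_pairing f) E E2.
have nX a b : X a < X b -> a != b by move=> l; apply/eqP => E; move: l; rewrite E ltxx.
have n12 : e.1 != e.2 by exact: nX.
have m12 : f.1 != f.2 by exact: nX.
have n1 : e.1 != f.2 by apply: nX; lra.
have n2 : f.1 != e.2 by apply: nX; lra.
have -> : [set e.1; e.2; f.1; f.2] = [set z in [:: e.1; e.2; f.1; f.2]].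
  by apply/setP => z; rewrite !inE !orbA.
rewrite cardsE; apply: (@etrans _ _ (size [:: e.1; e.2; f.1; f.2])) => //.
apply/card_uniqP.
by rewrite /= !inE !negb_or n12 n11 n1 (eq_sym e.2) n2 n22 m12.
Qed.

(* Apply [planar_defect] to the subgraph induced on a random set of vertices,
   each kept with probability 1/q, and average. *)
Lemma crossing_lemma (E : {set T * T}) (q : nat) :
  (forall e, e \in E -> is_edge [set: T] e) ->
  (q.+1 ^ 2 * #|E| <= 3 * q.+1 ^ 3 * #|T| + #|crossings E|)%N.
Proof.
move=> edgeE.
pose kept (f : {ffun T -> 'I_q.+1}) (D : {set T}) := [forall y in D, f y == ord0].
have hV := @sum_card_vanishing _ _ q 1 [set: T] (fun v => [set v])
  (fun v _ => cards1 v).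
have hE := @sum_card_vanishing _ _ q 2 E (fun e => [set e.1; e.2]).
have hC := @sum_card_vanishing _ _ q 4 (crossings E)
  (fun p => [set p.1.1; p.1.2; p.2.1; p.2.2]).
have {}hE := hE _.
have {}hE := hE (ltac:(move=> e /edgeE[_ _ l _]; rewrite cards2;
  case: eqVneq => // ee; move: l; rewrite ee ltxx //)).
have {}hC := hC (ltac:(move=> p; rewrite inE => /and3P[/edgeE e1 /edgeE e2 /asboolP c];
  exact: (crossing_endpoints [set: T] _ _ e1 e2 c))).
set SV := (\sum_f _)%N in hV; set SE := (\sum_f _)%N in hE.
set SC := (\sum_f _)%N in hC.
have main : (SE <= 3 * SV + SC)%N.
  rewrite /SE /SV /SC big_distrr /= -big_split /=; apply: leq_sum => f _.
  set Ef := [set e in E | _]; set Vf := [set v in _ | _]; set Cf := [set p in _ | _].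
  apply: (leq_trans (planar_defect Vf Ef _)).
    move=> e; rewrite inE => /andP[/edgeE[_ _ l n] /forallP k].
    split=> //; rewrite ?inE; last by move=> v _; exact: n.
    - by apply/forallP => y; apply/implyP; rewrite inE => /eqP->; have := k e.1;
        rewrite !inE eqxx.
    - by apply/forallP => y; apply/implyP; rewrite inE => /eqP->; have := k e.2;
        rewrite !inE eqxx orbT.
  rewrite leq_add2l; apply/subset_leq_card/fintype.subsetP => p.
  rewrite !inE => /and3P[/andP[-> /forallP k1] /andP[-> /forallP k2] ->] /=.
  apply/forallP => y; have := k1 y; have := k2 y; rewrite !inE.
  by do 4 case: (y == _) => //=.
rewrite cardsT in hV.
have qn : (0 < q.+1 ^ #|T|)%N by rewrite expn_gt0.
rewrite -(leq_pmul2r qn).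
have -> : (q.+1 ^ 2 * #|E| * q.+1 ^ #|T| = SE * q.+1 ^ 4)%N.
  by rewrite -mulnA -hE mulnCA -expnD.
have -> : ((3 * q.+1 ^ 3 * #|T| + #|crossings E|) * q.+1 ^ #|T|
           = (3 * SV + SC) * q.+1 ^ 4)%N.
  rewrite mulnDl -hC -mulnA -hV [RHS]mulnDl; congr (_ + _)%N.
  ring.
by rewrite leq_mul2r main orbT.
Qed.

End CrossingLemma.

(** * Rich lines *)

Section Lines.
Variables (R : realFieldType) (T : finType) (X Y : T -> R).

(** A line is encoded by its trace on the point set. For [p = r] the determinant condition is void
    and the trace is all of [T], hence the restriction to distinct pairs in [rich_lines]. *)
Definition line (p r : T) : {set T} :=
  [set s | (X r - X p) * (Y s - Y p) == (Y r - Y p) * (X s - X p)].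

Definition rich_lines (k : nat) : {set {set T}} :=
  [set l in [set line e.1 e.2 | e : T * T & e.1 != e.2] | (k <= #|l|)%N].

Lemma line_left p r : p \in line p r.
Proof. by rewrite inE !subrr !mulr0. Qed.

Lemma line_right p r : r \in line p r.
Proof. by rewrite inE mulrC. Qed.

Hypothesis injXY : forall i j, X i = X j -> Y i = Y j -> i = j.

Lemma lineP p r s : p != r ->
  reflect (exists t, X s = X p + t * (X r - X p) /\ Y s = Y p + t * (Y r - Y p))
          (s \in line p r).
Proof.
move=> npr; rewrite inE; apply: (iffP eqP) => [h|[t [-> ->]]]; last by ring.
case: (eqVneq (X r - X p) 0) => [dx|dx].
  have dy : Y r - Y p != 0.
    by apply: contraNneq npr => dy; apply/eqP/injXY; lra.
  exists ((Y s - Y p) / (Y r - Y p)); split; last by field.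
  rewrite dx mulr0; move: h; rewrite dx mul0r => /esym/eqP.
  by rewrite mulf_eq0 (negbTE dy) /= subr_eq0 addr0 => /eqP.
exists ((X s - X p) / (X r - X p)); split; first by field.
apply: (mulfI dx).
transitivity ((X r - X p) * Y p + (Y r - Y p) * (X s - X p)); last by field.
by rewrite -h; ring.
Qed.

Lemma line_eq p r s s' : p != r -> s != s' -> s \in line p r ->
  s' \in line p r -> line s s' = line p r.
Proof.
move=> npr nss /(lineP _ _ _ npr)[a [xa ya]] /(lineP _ _ _ npr)[b [xb yb]].
have ab : b - a != 0.
  by apply: contraNneq nss => ab; apply/eqP/injXY; rewrite ?xa ?xb ?ya ?yb;
    (have -> : a = b by lra).
apply/setP => z; rewrite !inE xa ya xb yb.
apply/eqP/eqP => h.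
  apply: (mulfI ab).
  have -> : (b - a) * ((X r - X p) * (Y z - Y p)) =
     (X p + b * (X r - X p) - (X p + a * (X r - X p))) *
     (Y z - (Y p + a * (Y r - Y p))) + (b - a) * a * (X r - X p) * (Y r - Y p) by ring.
  by rewrite h; ring.
have -> : (X p + b * (X r - X p) - (X p + a * (X r - X p))) *
     (Y z - (Y p + a * (Y r - Y p))) = (b - a) * ((X r - X p) * (Y z - Y p))
   - (b - a) * a * (X r - X p) * (Y r - Y p) by ring.
by rewrite h; ring.
Qed.

Lemma rich_linesP k l : reflect (exists p r, [/\ p != r, l = line p r & (k <= #|l|)%N])
  (l \in rich_lines k).
Proof.
rewrite inE; apply: (iffP andP) => [[/imsetP[e] + -> h]|[p [r [npr -> h]]]].
  by rewrite inE => ne; exists e.1, e.2.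
by split=> //; apply/imsetP; exists (p, r); rewrite ?inE.
Qed.

End Lines.

(** * The Szemeredi-Trotter bound for rich lines *)

Section SzemerediTrotterGeneric.
Variables (R : realFieldType) (T : finType) (X Y : T -> R).
Hypothesis injX : injective X.
Variable k : nat.
Local Notation height := (height R T X Y).
Local Notation slope := (slope R T X Y).
Local Notation crossing := (crossing R T X Y).
Local Notation is_edge := (is_edge R T X Y).
Local Notation line := (line R T X Y).
Local Notation rich := (rich_lines R T X Y k).

Let injXY i j : X i = X j -> Y i = Y j -> i = j.
Proof. by move=> /injX. Qed.

(** The graph of Szekely's argument, joining consecutive points of each rich line. Distinct
    abscissas exclude vertical lines, so the order can be read off [X]. *)
Definition line_edges : {set T * T} :=
  [set e | [&& X e.1 < X e.2, line e.1 e.2 \in rich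
             & [forall z in line e.1 e.2, ~~ (X e.1 < X z < X e.2)]]].

Lemma height_line e z : X e.1 < X e.2 ->
  (height e (X z) == Y z) = (z \in line e.1 e.2).
Proof.
move=> l; have d : X e.2 - X e.1 != 0 by rewrite subr_eq0 gt_eqF.
rewrite inE /height /slope; apply/eqP/eqP => [<-|h]; first by field.
apply: (mulfI d).
transitivity ((X e.2 - X e.1) * Y e.1 + (Y e.2 - Y e.1) * (X z - X e.1)).
  by field.
by rewrite -h; ring.
Qed.

Lemma line_edgesP e : e \in line_edges -> is_edge [set: T] e.
Proof.
rewrite inE => /and3P[l _ /forallP n]; split; rewrite ?inE // => v _ lv /eqP.
by rewrite height_line // => vl; have := n v; rewrite vl lv.
Qed.

Lemma line_edges_overlap e f x : e \in line_edges -> f \in line_edges ->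
  line e.1 e.2 = line f.1 f.2 -> X e.1 < x < X e.2 -> X f.1 < x < X f.2 -> e = f.
Proof.
rewrite !inE => /and3P[le _ /forallP ne] /and3P[lf _ /forallP nf] ef.
move=> /andP[e1 e2] /andP[f1 f2].
have ne1 := ne f.1; have ne2 := ne f.2; have nf1 := nf e.1; have nf2 := nf e.2.
rewrite -ef in nf1 nf2; rewrite ef in ne1 ne2.
rewrite !(line_left, line_right) /= in ne1 ne2 nf1 nf2.
have [a|a|/injX a] := ltgtP (X e.1) (X f.1).
- by case/negP: ne1; apply/andP; split; lra.
- by case/negP: nf1; apply/andP; split; lra.
have [b|b|/injX b] := ltgtP (X e.2) (X f.2).
- by case/negP: nf2; apply/andP; split; lra.
- by case/negP: ne2; apply/andP; split; lra.
by rewrite (surjective_pairing e) (surjective_pairing f) a b.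
Qed.

Lemma line_height_eq e f : X e.1 < X e.2 -> X f.1 < X f.2 ->
  line e.1 e.2 = line f.1 f.2 -> height e =1 height f.
Proof.
move=> le lf ef t.
have /eqP h1 : height e (X f.1) == Y f.1 by rewrite height_line // ef line_left.
have /eqP h2 : height e (X f.2) == Y f.2 by rewrite height_line // ef line_right.
have g1 := height_left _ _ X Y f; have g2 := height_right _ _ X Y f lf.
have s : slope e = slope f.
  have d : X f.2 - X f.1 != 0 by rewrite subr_eq0 gt_eqF.
  apply: (mulIf d).
  by rewrite -!(heightB _ _ X Y) h1 h2 g1 g2.
have := heightB _ _ X Y e t (X f.1); have := heightB _ _ X Y f t (X f.1).
rewrite s h1 g1; lra.
Qed.

(** Crossing edges lie on lines of different slopes. These meet in one point only, and it is
    interior to at most one edge of each line, so the two lines determine the crossing. *)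
Lemma crossings_line_edges :
  (#|crossings R T X Y line_edges| <= #|rich| ^ 2)%N.
Proof.
have -> : (#|rich| ^ 2 = #|finset.setX rich rich|)%N by rewrite cardsX.
apply: (@leq_card_inj_in _ _ _ _ (fun p => (line p.1.1 p.1.2, line p.2.1 p.2.2))).
  by move=> p; rewrite !inE /= => /and3P[/and3P[_ /andP[-> ->] _] /and3P[_ /andP[-> ->] _] _].
have main e f : e \in line_edges -> f \in line_edges -> crossing e f -> slope e <> slope f.
  move=> eE fE [nef [x [ex fx hx]]] s; apply: nef.
  apply: (line_edges_overlap _ _ _ eE fE _ ex fx).
  have [_ _ le _] := line_edgesP _ eE; have [_ _ lf _] := line_edgesP _ fE.
  apply/setP => z; rewrite -!height_line //; congr (_ == _).
  have := heightB _ _ X Y e (X z) x; have := heightB _ _ X Y f (X z) x.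
  rewrite s hx; lra.
have cP p : p \in crossings R T X Y line_edges ->
    [/\ p.1 \in line_edges, p.2 \in line_edges & crossing p.1 p.2].
  by rewrite finset.in_set => /and3P[? ? /asboolP].
move=> [e f] [e' f'] /cP[/= eE fE c] /cP[/= e'E f'E c'] [ee ff].
have s := main _ _ eE fE c.
have [_ _ le _] := line_edgesP _ eE; have [_ _ lf _] := line_edgesP _ fE.
have [_ _ le' _] := line_edgesP _ e'E; have [_ _ lf' _] := line_edgesP _ f'E.
have [_ [x [ex fx hx]]] := c; have [_ [x' [ex' fx' hx']]] := c'.
have xx : x = x'.
  move: hx'; rewrite -(line_height_eq e e') // -(line_height_eq f f') // => hx'.
  have := heightB _ _ X Y e x x'; have := heightB _ _ X Y f x x'.
  rewrite hx hx' => -> /esym/eqP; rewrite -subr_eq0 -mulrBl mulf_eq0 !subr_eq0.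
  by case/orP => /eqP.
rewrite -xx in ex' fx'.
by rewrite (line_edges_overlap e e' x) // (line_edges_overlap f f' x).
Qed.

(** Every point of a rich line except the rightmost one starts an edge, leading to its successor. *)
Lemma card_line_edges : (#|rich| * k.-1 <= #|line_edges|)%N.
Proof.
rewrite -[#|line_edges|]sum1_card.
rewrite (partition_big (fun e => line e.1 e.2) (mem rich)) /=; last first.
  by move=> e; rewrite [_ \in line_edges]inE => /and3P[].
rewrite -sum_nat_const; apply: leq_sum => l lr.
have /rich_linesP[p [r [npr ll lk]]] := lr.
have pl : p \in l by rewrite ll line_left.
case: (arg_maxP (P := fun i => i \in l) X pl) => m ml mmax.
have {}mmax z : z \in l -> X z <= X m := mmax z.
pose El := [set e in line_edges | line e.1 e.2 == l].
rewrite (eq_bigl (mem El)); last by move=> e; rewrite [RHS]inE.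
rewrite sum1_card.
apply: (@leq_trans #|l :\ m|).
  by have := cardsD1 m l; rewrite ml; move: lk; lia.
apply: leq_trans (leq_imset_card fst _).
apply/subset_leq_card/fintype.subsetP => u; rewrite in_setD1 => /andP[um ul].
have um' : X u < X m.
  by rewrite lt_neqAle mmax // andbT; apply: contraNneq um => /injX ->.
have Qm : (m \in l) && (X u < X m) by rewrite ml um'.
case: (arg_minP (P := fun w => (w \in l) && (X u < X w)) X Qm) => w /andP[wl uw] wmin.
have uwl : line u w = l.
  rewrite ll; apply: line_eq => //; rewrite -?ll //.
  by apply: contraTneq uw => ->; rewrite ltxx.
apply/imsetP; exists (u, w) => //; rewrite !inE /= uw uwl eqxx andbT /=.
apply/andP; split; last first.
  apply/forallP => z; apply/implyP => zl; apply/negP => /andP[uz zw].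
  by have := wmin z; rewrite zl uz => /(_ isT); rewrite leNgt zw.
by move: lr; rewrite inE.
Qed.

Lemma szemeredi_trotter_generic (q : nat) :
  (q.+1 ^ 2 * (#|rich| * k.-1) <= 3 * q.+1 ^ 3 * #|T| + #|rich| ^ 2)%N.
Proof.
have := crossing_lemma _ _ X Y injX line_edges q line_edgesP => h.
apply: (@leq_trans (q.+1 ^ 2 * #|line_edges|)%N).
  by rewrite leq_mul2l card_line_edges orbT.
by apply: (leq_trans h); rewrite leq_add2l crossings_line_edges.
Qed.

End SzemerediTrotterGeneric.

Section SzemerediTrotter.
Variables (R : realFieldType) (T : finType) (X Y : T -> R).
Hypothesis injXY : forall i j, X i = X j -> Y i = Y j -> i = j.

(** A shear parameter exceeding all ratios [F i j] separates the abscissas; collinearity is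
    unaffected, by [line_shear]. *)
Lemma exists_shear : exists t, injective (fun i => X i + t * Y i).
Proof.
pose F i j : R := `|(X i - X j) / (Y i - Y j)|.
have [S FS] : exists S : R, forall i j, F i j <= S.
  exists (\sum_i \sum_j F i j) => i j.
  rewrite (bigD1 i) //= (bigD1 j) //= -addrA ler_wpDr // addr_ge0 //.
    by apply: sumr_ge0 => ? _; rewrite normr_ge0.
  by apply: sumr_ge0 => ? _; apply: sumr_ge0 => ? _; rewrite normr_ge0.
exists (1 + S) => i j /= h.
case: (eqVneq (Y i) (Y j)) => yij; first by apply: injXY => //; move: h; rewrite yij; lra.
have d : Y i - Y j != 0 by rewrite subr_eq0.
have e : 1 + S = - ((X i - X j) / (Y i - Y j)).
  by apply: (mulIf d); rewrite mulNr divfK //; lra.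
have := ler_norm (- ((X i - X j) / (Y i - Y j))); rewrite normrN -/(F i j) -e.
by move=> /le_trans/(_ (FS i j)); rewrite gerDr ler10.
Qed.

Lemma line_shear t : line R T (fun i => X i + t * Y i) Y =2 line R T X Y.
Proof.
move=> p r; apply/setP => s; rewrite !inE -subr_eq0 -[RHS]subr_eq0.
by congr (_ == 0); ring.
Qed.

(** The factor [minn (k ^ 2) #|T|] covers in one formula the two regimes [N ^ 2 / k ^ 3] and
    [N / k]. *)
Lemma rich_bound (k : nat) : (2 <= k)%N ->
  (#|rich_lines R T X Y k| * minn (k ^ 2) #|T| * k <= 2304 * #|T| ^ 2)%N.
Proof.
move=> k2; have [t injX] := exists_shear.
have rE : rich_lines R T (fun i => X i + t * Y i) Y k = rich_lines R T X Y k.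
  apply/setP => l; apply/rich_linesP/rich_linesP => -[p [r [npr ll kl]]];
    exists p, r; split=> //; first by rewrite -(line_shear t).
  by rewrite line_shear.
have := szemeredi_trotter_generic _ _ _ Y injX k; rewrite rE.
set m := #|_|; set N := #|T|; set h := k.-1 => st.
have kh : (k <= 2 * h)%N by rewrite /h; lia.
have [c|c] := ltnP (m * h) (6 * N).
  have mk : (m * k <= 12 * N)%N by nia.
  have mn : (minn (k ^ 2) N <= N)%N by rewrite geq_minr.
  rewrite mulnAC; nia.
have [m0|m0] := posnP m; first by rewrite m0 !mul0n.
have N0 : (0 < N)%N.
  rewrite lt0n; apply/negP => /eqP N0.
  have : (m <= #|{set T}|)%N by rewrite max_card.
  have /card_gt0P[l /rich_linesP[p _]] := m0.
  by have /card0_eq/(_ p) := N0.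
(* With this choice the vertex term [3 * q ^ 3 * N] is at most half of [q ^ 2 * (m * h)], and the
   crossings must account for the other half. *)
pose q := ((m * h) %/ (6 * N))%N.
have q1 : (q * (6 * N) <= m * h)%N by rewrite leq_trunc_div.
have q2 : (m * h < q.+1 * (6 * N))%N by rewrite ltn_ceil // muln_gt0.
have q0 : (0 < q)%N by rewrite divn_gt0 ?muln_gt0.
have {st} := st q.-1; rewrite prednK // => st.
have st2 : (q ^ 2 * (m * h) <= 2 * m ^ 2)%N.
  have : (q ^ 2 * (q * (6 * N)) <= q ^ 2 * (m * h))%N by rewrite leq_mul2l q1 orbT.
  have -> : (q ^ 2 * (q * (6 * N)) = 2 * (3 * q ^ 3 * N))%N by ring.
  move: st; lia.
have q3 : (m * h <= 12 * q * N)%N by nia.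
have st3 : ((m * h) ^ 3 <= 288 * N ^ 2 * m ^ 2)%N.
  have : ((m * h) ^ 2 * (m * h) <= (12 * q * N) ^ 2 * (m * h))%N.
    by rewrite leq_mul2r leq_exp2r // q3 orbT.
  have -> : ((12 * q * N) ^ 2 * (m * h) = 144 * N ^ 2 * (q ^ 2 * (m * h)))%N by ring.
  have : (144 * N ^ 2 * (q ^ 2 * (m * h)) <= 144 * N ^ 2 * (2 * m ^ 2))%N.
    by rewrite leq_mul2l st2 orbT.
  have -> : ((m * h) ^ 2 * (m * h) = (m * h) ^ 3)%N by ring.
  have -> : (144 * N ^ 2 * (2 * m ^ 2) = 288 * N ^ 2 * m ^ 2)%N by ring.
  by move=> a b; apply: leq_trans b a.
have st4 : (m * h ^ 3 <= 288 * N ^ 2)%N.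
  have m2 : (0 < m ^ 2)%N by rewrite expn_gt0 m0.
  rewrite -(leq_pmul2r m2); apply: leq_trans st3.
  by rewrite leq_eqVlt; apply/orP; left; apply/eqP; ring.
apply: (@leq_trans (m * k ^ 2 * k)%N).
  by rewrite leq_mul2r leq_mul2l geq_minl !orbT.
apply: (@leq_trans (8 * (m * h ^ 3))%N); last first.
  by rewrite (_ : 2304 = 8 * 288)%N // -mulnA leq_mul2l st4 orbT.
have -> : (m * k ^ 2 * k = m * k ^ 3)%N by ring.
have -> : (8 * (m * h ^ 3) = m * (2 * h) ^ 3)%N by ring.
by rewrite leq_mul2l leq_exp2r // kh orbT.
Qed.

End SzemerediTrotter.

(** * Right angles *)

(** A discrete comparison with the integral of [min(t^2, N)] over [[0, n]]; the 3 is that of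
    [t^3 / 3]. It spreads the weight of a line over the thresholds [k] at which the line is rich. *)
Lemma cube_le_sum_min (N n : nat) : (2 <= n)%N ->
  (n * minn (n ^ 2) N <= 3 * \sum_(2 <= k < n.+1) minn (k ^ 2) N)%N.
Proof.
elim: n => // n IH; case: (ltngtP n 1) => [|n1 _|->]; first by case: n {IH}.
  rewrite big_nat_recr ?(leqW n1) //= mulnDr.
  have {IH} := IH n1; set S := \sum_(_ <= _ < _) _ => IH.
  suff : (n.+1 * minn (n.+1 ^ 2) N <= n * minn (n ^ 2) N + 3 * minn (n.+1 ^ 2) N)%N.
    by move: IH; clear; lia.
  rewrite /minn; case: ltnP => a; case: ltnP => b; nia.
by move=> _; rewrite big_nat1 leq_mul2r orbT.
Qed.

(** Each block [2 ^ J < k <= 2 ^ J.+1] contributes at most 1. *)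
Lemma harmonic_dyadic (R : realFieldType) (J : nat) :
  \sum_(2 <= k < (2 ^ J).+1) (k%:R^-1 : R) <= J%:R.
Proof.
elim: J => [|J IH]; first by rewrite big_geq.
rewrite (@big_cat_nat _ _ _ (2 ^ J).+1) //=; first last.
- by rewrite ltnS leq_exp2l.
- by rewrite ltnS expn_gt0.
rewrite -natr1 lerD //.
have p0 : 0 < (2 ^ J)%:R :> R by rewrite ltr0n expn_gt0.
apply: (@le_trans _ _ (\sum_((2 ^ J).+1 <= k < (2 ^ J.+1).+1) ((2 ^ J)%:R^-1 : R))).
  rewrite big_nat_cond [leRHS]big_nat_cond; apply: ler_sum => k.
  rewrite andbT => /andP[k1 _].
  by rewrite lef_pV2 ?posrE // ?ler_nat ?ltr0n; lia.
rewrite sumr_const_nat -[leLHS]mulr_natl expnS subSS.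
have -> : (2 * 2 ^ J - 2 ^ J = 2 ^ J)%N by lia.
by rewrite divff // gt_eqF.
Qed.

Lemma sum_card_dep (S T : finType) (P : pred S) (F : S -> {set T}) :
  (\sum_(p | P p) #|F p| = #|[set e : S * T | P e.1 && (e.2 \in F e.1)]|)%N.
Proof.
rewrite -sum1dep_card -(pair_big_dep P (fun p s => s \in F p) (fun _ _ => 1%N)) /=.
by apply: eq_bigr => p _; rewrite sum1_card.
Qed.

Section RightAngles.
Variables (R : realFieldType) (T : finType) (X Y : T -> R).
Hypothesis injXY : forall i j, X i = X j -> Y i = Y j -> i = j.
Local Notation line := (line R T X Y).
Local Notation rich := (rich_lines R T X Y).

Definition perp (p r s : T) : bool :=
  (X r - X p) * (X s - X p) + (Y r - Y p) * (Y s - Y p) == 0.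

(** The points [s] for which the right angle at [p] is charged to the leg towards [r]; a tie is
    charged to both legs. *)
Definition short_legs (p r : T) : {set T} :=
  [set s | [&& s != p, perp p r s & (#|line p s| <= #|line p r|)%N]].

Lemma dist_gt0 p r : p != r -> 0 < (X r - X p) ^+ 2 + (Y r - Y p) ^+ 2.
Proof.
move=> npr; rewrite lt_neqAle addr_ge0 ?sqr_ge0 // andbT eq_sym.
rewrite paddr_eq0 ?sqr_ge0 // !sqrf_eq0 !subr_eq0.
apply: contraNN npr => /andP[/eqP x /eqP y].
by apply/eqP/esym/injXY.
Qed.

(** All these points lie on one perpendicular, which is [line p s0] for any [s0] among them and so
    carries at most [#|line p r|] points. *)
Lemma card_short_legs p r : p != r -> (#|short_legs p r| <= #|line p r|)%N.
Proof.
move=> npr; have [->|/set0Pn[s0 s0D]] := eqVneq (short_legs p r) finset.set0.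
  by rewrite cards0.
move: (s0D); rewrite inE => /and3P[ns0 /eqP o0 /(leq_trans _)]; apply.
apply/subset_leq_card/fintype.subsetP => s; rewrite !inE => /and3P[ns /eqP o _].
rewrite -subr_eq0; set d := X r - X p in o o0; set e := Y r - Y p in o o0.
have := dist_gt0 _ _ npr; rewrite -/d -/e => de.
rewrite -(mulrI_eq0 _ (mulfI (lt0r_neq0 de))); apply/eqP.
(* For [u = r - p], [v0 = s0 - p], [v = s - p] this is [|u|^2 (v0 x v) = (u.v0)(u x v) - (u.v)(u x
   v0)], and both inner products vanish. *)
transitivity ((d * (X s0 - X p) + e * (Y s0 - Y p)) * (d * (Y s - Y p) - e * (X s - X p))
  - (d * (X s - X p) + e * (Y s - Y p)) * (d * (Y s0 - Y p) - e * (X s0 - X p))).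
  by ring.
by rewrite o o0; ring.
Qed.

Lemma short_legs_disjoint p p' r s : p != r -> p' != r -> line p r = line p' r ->
  s \in short_legs p r -> s \in short_legs p' r -> p = p'.
Proof.
move=> npr npr' ll; rewrite !inE => /and3P[_ /eqP o _] /and3P[_ /eqP o' _].
have /(lineP _ _ _ _ injXY _ _ _ npr)[t [xt yt]] : p' \in line p r.
  by rewrite ll line_left.
have t1 : 1 - t != 0.
  rewrite subr_eq0; apply: contraNneq npr' => t1; apply/eqP/injXY.
    by rewrite xt -t1; ring.
  by rewrite yt -t1; ring.
have := dist_gt0 _ _ npr => d0.
(* With [p' = p + t (r - p)], [1 - t] times the relation at [p] minus the relation at [p'] reads
   [t (1 - t) |r - p|^2 = 0]. *)
have : t * ((X r - X p) ^+ 2 + (Y r - Y p) ^+ 2) = 0.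
  apply: (mulfI t1); rewrite mulr0.
  transitivity ((1 - t) * ((X r - X p) * (X s - X p) + (Y r - Y p) * (Y s - Y p))
    - ((X r - X p') * (X s - X p') + (Y r - Y p') * (Y s - Y p'))).
    by rewrite xt yt; ring.
  by rewrite o o'; ring.
move/eqP; rewrite mulf_eq0 (gt_eqF d0) orbF => /eqP t0.
by apply: injXY; rewrite ?xt ?yt t0; ring.
Qed.

(* The cubic bound counts pairs on [l] and uses [card_short_legs]; the linear one
   holds because the perpendiculars to [l] at distinct points are disjoint. *)
Lemma sum_short_legs_line l : l \in rich 2 ->
  (\sum_(e : T * T | (e.1 != e.2) && (line e.1 e.2 == l)) #|short_legs e.1 e.2|
   <= #|l| * minn (#|l| ^ 2) #|T|)%N.
Proof.
move=> lr; rewrite minnMr leq_min; apply/andP; split.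
  apply: (@leq_trans (\sum_(e in finset.setX l l) #|l|)).
    rewrite big_mkcond [leqRHS]big_mkcond; apply: leq_sum => -[p r] _ /=.
    case: ifP => // /andP[npr /eqP <-]; rewrite finset.in_setX line_left line_right.
    exact: card_short_legs.
  by rewrite sum_nat_const cardsX; apply/eq_leq; ring.
rewrite (eq_bigl (fun e : T * T => true && ((e.1 != e.2) && (line e.1 e.2 == l)))) //.
rewrite -(pair_big_dep xpredT (fun p r => (p != r) && (line p r == l))
  (fun p r => #|short_legs p r|)) /=.
rewrite (exchange_big_dep (fun r => r \in l)) /=; last first.
  by move=> p r _ /andP[_ /eqP <-]; rewrite line_right.
rewrite -sum_nat_const; apply: leq_sum => r rl.
rewrite sum_card_dep -cardsT.
apply: (@leq_card_inj_in _ _ _ _ snd); first by move=> *; rewrite inE.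
move=> [p s] [p' s']; rewrite finset.in_set /= => /andP[/andP[npr /eqP pl] ps].
rewrite finset.in_set /= => /andP[/andP[npr' /eqP pl'] ps'] /= ss.
rewrite -ss in ps' *; congr (_, _).
by apply: (short_legs_disjoint _ _ _ _ npr npr' _ ps ps'); rewrite pl pl'.
Qed.

(** After exchanging the sums over lines and thresholds, [rich_bound] makes the term of [k] at most
    [2304 * N ^ 2 / k], and the harmonic sum gives [J]. The constant is 3 times 2304. *)
Lemma sum_short_legs J : (#|T| <= 2 ^ J)%N ->
  (\sum_(e : T * T | e.1 != e.2) #|short_legs e.1 e.2| <= 6912 * #|T| ^ 2 * J)%N.
Proof.
move=> TJ; rewrite (partition_big (fun e => line e.1 e.2) (mem (rich 2))) /=; last first.
  move=> e ne; apply/rich_linesP; exists e.1, e.2; split=> //.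
  by apply/card_gt1P; exists e.1, e.2; split=> //; rewrite (line_left, line_right).
apply: (@leq_trans (\sum_(l in rich 2) 3 * \sum_(2 <= k < #|l|.+1) minn (k ^ 2) #|T|)).
  apply: leq_sum => l lr; apply: (leq_trans (sum_short_legs_line _ lr)).
  by apply: cube_le_sum_min; have /rich_linesP[? [? []]] := lr.
apply: (@leq_trans (3 * \sum_(2 <= k < #|T|.+1) #|rich k| * minn (k ^ 2) #|T|)).
  rewrite -big_distrr leq_mul2l /=; apply/eq_leq.
  transitivity (\sum_(l in rich 2) \sum_(2 <= k < #|T|.+1)
      (if (k <= #|l|)%N then minn (k ^ 2) #|T| else 0))%N.
    apply: eq_bigr => l _; rewrite (big_nat_widen _ _ #|T|.+1) ?ltnS ?max_card //=.
    by rewrite big_mkcond.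
  rewrite exchange_big /= big_nat [RHS]big_nat; apply: eq_bigr => k /andP[k2 _].
  rewrite -sum_nat_const -big_mkcondr /=; apply: eq_bigl => l.
  rewrite !inE -andbA; congr (_ && _).
  by apply/andP/idP => [[] //|kl]; rewrite (leq_trans k2).
rewrite -(ler_nat R).
apply: (@le_trans _ _ (3 * \sum_(2 <= k < #|T|.+1) (2304 * (#|T| ^ 2)%:R * k%:R^-1) : R)).
  rewrite natrM natr_sum ler_wpM2l //.
  rewrite big_nat_cond [leRHS]big_nat_cond; apply: ler_sum => k.
  rewrite andbT => /andP[k2 _].
  rewrite ler_pdivlMr ?ltr0n ?(ltn_trans _ k2) //.
  by rewrite -!natrM ler_nat rich_bound.
rewrite -big_distrr /= mulrA -!natrM.
have -> : (3 * (2304 * #|T| ^ 2))%N = (6912 * #|T| ^ 2)%N by rewrite mulnA.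
rewrite -[leRHS]/((_ * J)%:R) [leRHS]natrM ler_wpM2l //.
apply: le_trans (harmonic_dyadic R J).
have [T1|T1] := ltnP #|T|.+1 2.
  by rewrite big_geq ?(ltnW T1) // sumr_ge0 // => k _; rewrite invr_ge0.
have TJ' : (#|T|.+1 <= (2 ^ J).+1)%N by [].
rewrite [leRHS](big_cat_nat T1 TJ') /= lerDl.
by apply: sumr_ge0 => k _; rewrite invr_ge0.
Qed.

(** The degenerate triples, [r = p] or [s = p], number at most [2 * N ^ 2] and are paid for by
    passing from [J] to [J.+1]. Every other right angle is charged to one of its two legs, whence
    twice 6912. *)
Lemma count_perp J : (#|T| <= 2 ^ J)%N ->
  (\sum_p \sum_r \sum_s perp p r s <= 13824 * #|T| ^ 2 * J.+1)%N.
Proof.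
move=> TJ.
have -> : (13824 * #|T| ^ 2 * J.+1 = 13824 * #|T| ^ 2 + 2 * (6912 * #|T| ^ 2 * J))%N by ring.
apply: (@leq_trans (2 * #|T| ^ 2 + 2 * (6912 * #|T| ^ 2 * J))%N); last first.
  by rewrite leq_add2r leq_mul2r orbT.
pose D p r := (if p != r then #|short_legs p r| else 0)%N.
have DE : (\sum_p \sum_r D p r <= 6912 * #|T| ^ 2 * J)%N.
  apply: leq_trans (sum_short_legs J TJ).
  by rewrite pair_big [leqRHS]big_mkcond.
have pt p r s : (perp p r s <= (r == p) + (s == p) + (p != r) * (s \in short_legs p r)
    + (p != s) * (r \in short_legs p s))%N.
  have [->|nr] := eqVneq r p; first by case: perp.
  have [->|ns] := eqVneq s p; first by case: perp.
  rewrite !inE nr ns /= !mul1n !add0n.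
  have -> : perp p s r = perp p r s by rewrite /perp; congr (_ == _); ring.
  by case: perp => //=; case: (leqP #|line p s| #|line p r|) => // /ltnW ->; rewrite addnC.
apply: (@leq_trans (\sum_p \sum_r \sum_s ((r == p) + (s == p)
    + (p != r) * (s \in short_legs p r) + (p != s) * (r \in short_legs p s)))%N).
  apply: leq_sum => p _; apply: leq_sum => r _; apply: leq_sum => s _.
  exact: pt.
have sumD p r : (\sum_s (p != r) * (s \in short_legs p r) = D p r)%N.
  rewrite -big_distrr /= /D; case: (p != r); rewrite ?mul0n // mul1n.
  rewrite -sum1_card [RHS]big_mkcond /=.
  by apply: eq_bigr => s _; case: (s \in _).
have sum1 (p : T) : (\sum_r (r == p) = 1)%N.
  by rewrite (bigD1 p) //= eqxx big1 // => r /negbTE ->.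
have sumr : (\sum_p \sum_r \sum_s ((r == p) + (s == p)
    + (p != r) * (s \in short_legs p r) + (p != s) * (r \in short_legs p s))
  = \sum_(p : T) \sum_(r : T) \sum_(s : T) (r == p) +
    \sum_(p : T) \sum_(r : T) \sum_(s : T) (s == p) +
    \sum_p \sum_r D p r + \sum_p \sum_s D p s)%N.
  rewrite -!big_split; apply: eq_bigr => p _ /=.
  rewrite -big_split -[X in (X + _)%N]big_split /=.
  rewrite [X in (_ + X)%N](_ : _ =
    \sum_(s : T) \sum_(r : T) (p != s) * (r \in short_legs p s))%N;
    last by apply: eq_bigr => s _; rewrite sumD.
  rewrite [X in (_ + X)%N]exchange_big /= -!big_split /=; apply: eq_bigr => r _.
  by rewrite -sumD -!big_split.
rewrite sumr.
under eq_bigr => p _ do under eq_bigr => r _ do rewrite sum_nat_const.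
under eq_bigr => p _ do rewrite -big_distrr /= sum1 muln1.
under [X in (_ + X + _ + _ <= _)%N]eq_bigr => p _ do
  under eq_bigr => r _ do rewrite sum1.
rewrite !sum_nat_const !muln1 -!mulnn.
move: DE; set S := (\sum_p \sum_r D p r)%N; rewrite -mulnn.
set P := (#|T| * #|T|)%N; set Q := (_ * P * J)%N; clearbody P Q S; clear; lia.
Qed.
End RightAngles.

(** * Trigonometric integrals over cubes *)

Local Open Scope classical_set_scope.
Local Open Scope ring_scope.

Section Lebesgue2.
Variable R : realType.

(* A named constant, so that the product can be given the sigma-finite structure
   that Fubini's theorem on the triple product requires. *)
Definition lebesgue2 : set (measurableTypeR R * measurableTypeR R)%type -> \bar R :=
  (@lebesgue_measure R \x @lebesgue_measure R)%E.

HB.instance Definition _ := Measure.on lebesgue2.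

Let lebesgue2_sigma_finite :
  sigma_finite [set: measurableTypeR R * measurableTypeR R] lebesgue2.
Proof.
have [F FT Foo] := sigma_finiteT (@lebesgue_measure R).
pose G (n : nat) :=
  if @choice.unpickle (nat * nat)%type n is Some (i, j) then F i `*` F j else set0.
exists G => [|n].
  apply/esym/seteqP; split=> // -[x y] _.
  have [i _ xi] : (\bigcup_i F i) x by rewrite -FT.
  have [j _ yj] : (\bigcup_i F i) y by rewrite -FT.
  by exists (choice.pickle (i, j)) => //; rewrite /G choice.pickleK.
rewrite /G; case: choice.unpickle => [[i j]|]; last by split; rewrite ?measure0.
have [mi fi] := Foo i; have [mj fj] := Foo j; split; first exact: measurableX.
by rewrite /lebesgue2 product_measure1E // lte_mul_pinfty // ge0_fin_numE.
Qed.

HB.instance Definition _ :=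
  Measure_isSigmaFinite.Build _ _ _ lebesgue2 lebesgue2_sigma_finite.

End Lebesgue2.

Section IntegralTrig.
Variable R : realType.
Local Notation mu := (@lebesgue_measure R).

Lemma is_derive_trig (A B s eta t : R) : eta != 0 ->
  is_derive t 1 (fun t => eta^-1 * (A * sin (s + eta * t) - B * cos (s + eta * t)))
    (A * cos (s + eta * t) + B * sin (s + eta * t)).
Proof.
move=> eta0.
have d0 : is_derive t 1 (fun t => s + eta * t) eta.
  have := is_deriveD (is_derive_cst s t 1) (is_deriveZ eta (is_derive_id t 1)).
  by rewrite add0r /GRing.scale /= mulr1.
have ds : is_derive t 1 (fun t => sin (s + eta * t)) (cos (s + eta * t) * eta).
  exact: (@is_derive1_comp _ sin (fun t => s + eta * t)).
have dc : is_derive t 1 (fun t => cos (s + eta * t)) (- sin (s + eta * t) * eta).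
  exact: (@is_derive1_comp _ cos (fun t => s + eta * t)).
apply: (is_derive_eq (is_deriveZ eta^-1 (is_deriveB (is_deriveZ A ds) (is_deriveZ B dc)))).
by rewrite /GRing.scale /=; field.
Qed.

Lemma continuous_trig (A B s eta : R) :
  continuous (fun t => A * cos (s + eta * t) + B * sin (s + eta * t)).
Proof.
move=> t.
have clin : s + eta * t0 @[t0 --> t] --> s + eta * t.
  by apply: cvgD; [exact: cvg_cst | apply: cvgM; [exact: cvg_cst | exact: cvg_id]].
apply: cvgD; (apply: cvgM; first exact: cvg_cst).
  by apply: (cvg_comp _ _ clin); exact: continuous_cos.
by apply: (cvg_comp _ _ clin); exact: continuous_sin.
Qed.

(** Integration preserves the shape [A cos s + B sin s] in the phase [s]; with the other coordinates
    hidden in [s], the step can be iterated. The 4 arises because each amplitude meets an increment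
    of [sin] and one of [cos], both at most 2. *)
Lemma integral_trig1 (eta a b A B : R) : a < b ->
  exists A' B', [/\ forall s,
      (\int[mu]_(t in `[a, b]) (A * cos (s + eta * t) + B * sin (s + eta * t))%:E
       = (A' * cos s + B' * sin s)%:E)%E,
    `|A'| + `|B'| <= (if eta == 0 then b - a else 4 / `|eta|) * (`|A| + `|B|)
    & eta = 0 -> A' = (b - a) * A].
Proof.
move=> ab; have [->|eta0] := eqVneq eta 0.
  exists ((b - a) * A), ((b - a) * B); split=> //; last first.
    by rewrite !normrM mulrDr ger0_norm // subr_ge0 ltW.
  move=> s; under eq_integral do rewrite mul0r addr0.
  rewrite integral_cst //= lebesgue_measure_itv /= lte_fin ab -EFinD -EFinM.
  by congr EFin; ring.
pose S := sin (eta * b) - sin (eta * a); pose C := cos (eta * b) - cos (eta * a).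
exists (eta^-1 * (A * S - B * C)), (eta^-1 * (A * C + B * S)); split.
- move=> s; pose F t := eta^-1 * (A * sin (s + eta * t) - B * cos (s + eta * t)).
  have dF t := is_derive_trig A B s eta t eta0.
  have cF : continuous F.
    by move=> t; apply: differentiable_continuous; apply/derivable1_diffP; case: (dF t).
  rewrite (@continuous_FTC2 _ _ F) //.
  + rewrite -EFinB /F !sinD !cosD /S /C; congr EFin; ring.
  + by apply: continuous_subspaceT; exact: continuous_trig.
  + split=> [t _||]; first by case: (dF t).
    * by apply: cvg_at_right_filter; exact: cF.
    * by apply: cvg_at_left_filter; exact: cF.
  + by move=> t _; rewrite derive1E; case: (dF t).
- have S2 : `|S| <= 2.
    by rewrite (le_trans (ler_normB _ _)) // -[2]/(1 + 1) lerD ?sin_max.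
  have C2 : `|C| <= 2.
    by rewrite (le_trans (ler_normB _ _)) // -[2]/(1 + 1) lerD ?cos_max.
  rewrite !normrM -mulrDr normfV [4 / _]mulrC -mulrA ler_wpM2l ?invr_ge0 //.
  have h1 := ler_normB (A * S) (B * C); have h2 := ler_normD (A * C) (B * S).
  rewrite !normrM in h1 h2.
  have a1 := ler_wpM2l (normr_ge0 A) S2; have a2 := ler_wpM2l (normr_ge0 A) C2.
  have a3 := ler_wpM2l (normr_ge0 B) S2; have a4 := ler_wpM2l (normr_ge0 B) C2.
  lra.
- by move=> eta1; rewrite eta1 eqxx in eta0.
Qed.

Lemma integral_setX d1 d2 (T1 : measurableType d1) (T2 : measurableType d2)
  (m1 : {sigma_finite_measure set T1 -> \bar R})
  (m2 : {sigma_finite_measure set T2 -> \bar R}) (D1 : set T1) (D2 : set T2)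
  (f : T1 * T2 -> \bar R) : measurable D1 -> measurable D2 ->
  (m1 \x m2)%E.-integrable (D1 `*` D2) f ->
  (\int[(m1 \x m2)%E]_(z in D1 `*` D2) f z =
   \int[m1]_(x in D1) \int[m2]_(y in D2) f (x, y))%E.
Proof.
move=> mD1 mD2 intf; rewrite integral_mkcond -integral12_prod_meas1; last first.
  exact: (integrable_mkcond f (measurableX mD1 mD2)).1.
rewrite [RHS]integral_mkcond; apply: eq_integral => x _; rewrite /fubini_F.
rewrite patchE; case: ifPn => [xD|xD].
  rewrite [RHS]integral_mkcond; apply: eq_integral => y _.
  rewrite !patchE; congr (if _ then _ else _).
  by apply/idP/idP; rewrite !inE; [case | move=> yD; split=> //; exact: set_mem].
apply: integral0_eq => y _; rewrite patchE ifN //.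
by apply: contra xD; rewrite !inE => -[].
Qed.

Definition trig (A B : R) (eta x : R * R * R) : R :=
  A * cos (2 * pi * dot3 eta x) + B * sin (2 * pi * dot3 eta x).

Definition box3 (c : R * R * R) (r : R) : set (R * R * R) :=
  (`[c.1.1 - r, c.1.1 + r] `*` `[c.1.2 - r, c.1.2 + r]) `*` `[c.2 - r, c.2 + r].

Local Notation R3 := (measurableTypeR R * measurableTypeR R * measurableTypeR R)%type.

Lemma measurable_box3 c r : measurable (box3 c r : set R3).
Proof. by apply: measurableX; [apply: measurableX|]; exact: measurable_itv. Qed.

Lemma measurable_dot3 (eta : R * R * R) :
  measurable_fun [set: R3] (fun x : R3 => dot3 eta x).
Proof.
rewrite /dot3; apply: measurable_funD; first apply: measurable_funD.
- apply: measurable_funM; first exact: measurable_cst.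
  by apply: measurableT_comp => //; exact: measurable_fst.
- apply: measurable_funM; first exact: measurable_cst.
  by apply: measurableT_comp => //; exact: measurable_snd.
- by apply: measurable_funM; [exact: measurable_cst | exact: measurable_snd].
Qed.

Lemma measurable_trig (A B : R) eta : measurable_fun [set: R3] (trig A B eta).
Proof.
have m2 : measurable_fun [set: R3] (fun x : R3 => 2 * pi * dot3 eta x).
  by apply: measurable_funM; [exact: measurable_cst | exact: measurable_dot3].
apply: measurable_funD; (apply: measurable_funM; first exact: measurable_cst).
  by apply: measurableT_comp m2; apply: continuous_measurable_fun; exact: continuous_cos.
by apply: measurableT_comp m2; apply: continuous_measurable_fun; exact: continuous_sin.
Qed.

Lemma trig_le A B eta x : `|trig A B eta x| <= `|A| + `|B|.
Proof.
apply: (le_trans (ler_normD _ _)); rewrite !normrM lerD // ler_piMr //.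
  exact: cos_max.
exact: sin_max.
Qed.

Lemma lebesgue3_box3 c (r : R) : 0 < r -> @lebesgue3 R (box3 c r) = ((2 * r) ^+ 3)%:E.
Proof.
move=> r0; have h (x : R) : mu `[x - r, x + r] = (2 * r)%:E.
  rewrite lebesgue_measure_itv /= lte_fin ifT; last lra.
  by rewrite -EFinD; congr EFin; ring.
have mI (x : R) : measurable (`[x - r, x + r] : set (measurableTypeR R)).
  exact: measurable_itv.
apply: (etrans (@product_measure1E _ _ _ _ _ (mu \x mu)%E mu _ _
  (measurableX (mI _) (mI _)) (mI _))).
rewrite [X in (X * _)%E](product_measure1E _ _ (mI _) (mI _)).
by rewrite [LHS]/= !h -!EFinM; congr EFin; ring.
Qed.

Lemma integrable_trig A B eta c (r : R) : 0 < r ->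
  (@lebesgue3 R).-integrable (box3 c r) (EFin \o trig A B eta).
Proof.
move=> r0; apply: measurable_bounded_integrable.
- exact: measurable_box3.
- by rewrite lebesgue3_box3 // ltry.
- by apply: measurable_funTS; exact: measurable_trig.
exists (`|A| + `|B|); split; first exact: num_real.
by move=> M ltM x _; apply: le_trans (ltW ltM); exact: trig_le.
Qed.

(* Up to the amplitude, the integral of an oscillation of frequency [eta] over an
   interval of length [2 r] is at most this. *)
Definition side (r eta : R) : R := if eta == 0 then 2 * r else 4 / `|2 * pi * eta|.

Lemma side_ge0 (r eta : R) : 0 < r -> 0 <= side r eta.
Proof.
by move=> r0; rewrite /side; case: ifP => _; rewrite ?divr_ge0 // mulr_ge0 ?ltW.
Qed.

(** Coordinates not yet integrated enter only through the phase, which is 0 at the end. The exact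
    value at frequency 0 is what produces the energy later. *)
Lemma integral_trig A B eta c (r : R) : 0 < r ->
  exists I : R, [/\ (\int[@lebesgue3 R]_(x in box3 c r) (trig A B eta x)%:E = I%:E)%E,
    `|I| <= side r eta.1.1 * side r eta.1.2 * side r eta.2 * (`|A| + `|B|)
    & eta = 0 -> I = (2 * r) ^+ 3 * A].
Proof.
move=> r0; have itv (x : R) : x - r < x + r by lra.
have pi0 : 2 * pi != 0 :> R by rewrite mulf_neq0 // gt_eqF // pi_gt0.
have sideE x : (if 2 * pi * x == 0 then 2 * r else 4 / `|2 * pi * x|) = side r x.
  by rewrite /side mulf_eq0 (negbTE pi0).
have len (x : R) : x + r - (x - r) = 2 * r by ring.
have [A3 [B3 [h3 b3 z3]]] := integral_trig1 (2 * pi * eta.2) _ _ A B (itv c.2).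
have [A2 [B2 [h2 b2 z2]]] := integral_trig1 (2 * pi * eta.1.2) _ _ A3 B3 (itv c.1.2).
have [A1 [B1 [h1 b1 z1]]] := integral_trig1 (2 * pi * eta.1.1) _ _ A2 B2 (itv c.1.1).
rewrite !len !sideE in b1 b2 b3 z1 z2 z3.
have mI (x : R) : measurable (`[x - r, x + r] : set (measurableTypeR R)).
  exact: measurable_itv.
pose I1 : set (measurableTypeR R) := [set` `[c.1.1 - r, c.1.1 + r]].
pose I2 : set (measurableTypeR R) := [set` `[c.1.2 - r, c.1.2 + r]].
pose f2 (x : R * R) := A3 * cos (2 * pi * (eta.1.1 * x.1 + eta.1.2 * x.2)) +
      B3 * sin (2 * pi * (eta.1.1 * x.1 + eta.1.2 * x.2)).
pose f1 x := A2 * cos (2 * pi * (eta.1.1 * x)) + B2 * sin (2 * pi * (eta.1.1 * x)).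
have E3 : (\int[@lebesgue3 R]_(x in box3 c r) (trig A B eta x)%:E =
   \int[(mu \x mu)%E]_(x in I1 `*` I2) (f2 x)%:E)%E.
  have i12 := @integral_setX _ _ _ _ (lebesgue2 R) mu (I1 `*` I2) _
    (EFin \o trig A B eta) (measurableX (mI _) (mI _)) (mI c.2)
    (integrable_trig A B eta c r r0).
  apply: (etrans i12).
  apply: eq_integral => x _; rewrite -h3; apply: eq_integral => t _.
  by rewrite /trig /dot3 /=; congr (_ * cos _ + _ * sin _)%:E; ring.
have E2 : (\int[(mu \x mu)%E]_(x in I1 `*` I2) (f2 x)%:E =
   \int[mu]_(x in I1) (f1 x)%:E)%E.
  rewrite (integral_setX _ _ _ _ _ _ _ _ _ (mI _) (mI _)); last first.
    apply: measurable_bounded_integrable.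
    - exact: (measurableX (mI _) (mI _)).
    - have h (x : R) : mu [set` `[x - r, x + r]] = (2 * r)%:E.
        rewrite lebesgue_measure_itv /= lte_fin itv -EFinD.
        by congr EFin; ring.
      have : ((2 * r)%:E * (2 * r)%:E < +oo)%E by rewrite -EFinM ltry.
      rewrite -{1}(h c.1.1) -(h c.1.2) -(product_measure1E mu mu (mI _) (mI _)).
      exact: id.
    - apply: measurable_funTS.
      have m2 : measurable_fun [set: measurableTypeR R * measurableTypeR R]
          (fun x => 2 * pi * (eta.1.1 * x.1 + eta.1.2 * x.2)).
        apply: measurable_funM; first exact: measurable_cst.
        apply: measurable_funD; (apply: measurable_funM; first exact: measurable_cst).
          exact: measurable_fst.
        exact: measurable_snd.
      apply: measurable_funD; (apply: measurable_funM; first exact: measurable_cst).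
        by apply: measurableT_comp m2; apply: continuous_measurable_fun; exact: continuous_cos.
      by apply: measurableT_comp m2; apply: continuous_measurable_fun; exact: continuous_sin.
    exists (`|A3| + `|B3|); split; first exact: num_real.
    move=> M ltM x _; apply: le_trans (ltW ltM).
    apply: (le_trans (ler_normD _ _)); rewrite !normrM lerD // ler_piMr //.
      exact: cos_max.
    exact: sin_max.
  apply: eq_integral => x _; apply: etrans (h2 _); apply: eq_integral => t _.
  by rewrite /f2 /=; congr (_ * cos _ + _ * sin _)%:E; ring.
exists A1; split.
- rewrite E3 E2.
  transitivity (A1 * cos 0 + B1 * sin 0)%:E; last by rewrite cos0 sin0 mulr1 mulr0 addr0.
  rewrite -h1; apply: eq_integral => t _.
  by rewrite /f1; congr (_ * cos _ + _ * sin _)%:E; ring.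
- apply: (@le_trans _ _ (`|A1| + `|B1|)); first by rewrite lerDl.
  apply: (le_trans b1); rewrite -!mulrA ler_wpM2l ?side_ge0 //.
  by apply: (le_trans b2); rewrite ler_wpM2l ?side_ge0.
- move=> eta0; rewrite z1 ?z2 ?z3 ?eta0 /= ?mulr0 //; ring.
Qed.

End IntegralTrig.

(** * The fourth moment over a cube *)

Local Notation normc := ComplexField.Normc.normc.

Section FourthPower.
Variable R : realType.
Implicit Types (z : R[i]) (p x : R * R * R).

Lemma normc_ge0 z : 0 <= normc z.
Proof. by case: z => a b; exact: sqrtr_ge0. Qed.

Lemma Re_le_normc z : `|complex.Re z| <= normc z.
Proof. by case: z => a b /=; rewrite -sqrtr_sqr ler_wsqrtr // lerDl sqr_ge0. Qed.

Lemma Im_le_normc z : `|complex.Im z| <= normc z.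
Proof. by case: z => a b /=; rewrite -sqrtr_sqr ler_wsqrtr // lerDr sqr_ge0. Qed.

Lemma normc_conjc z : normc (conjc z) = normc z.
Proof. by case: z => a b /=; rewrite sqrrN. Qed.

Lemma normc_sum (I : Type) (s : seq I) (P : pred I) (f : I -> R[i]) :
  normc (\sum_(i <- s | P i) f i) <= \sum_(i <- s | P i) normc (f i).
Proof.
elim/big_ind2 : _ => //; first by rewrite ComplexField.Normc.normc0.
by move=> z1 y1 z2 y2 h1 h2; apply: le_trans (lerD h1 h2); exact: le_normcD.
Qed.

Lemma Re_sum (I : Type) (s : seq I) (f : I -> R[i]) :
  complex.Re (\sum_(i <- s) f i) = \sum_(i <- s) complex.Re (f i).
Proof. by apply: (big_morph (@complex.Re R)) => // -[a b] [c d]. Qed.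

Lemma normc_exp4 z : normc z ^+ 4 = complex.Re (z * z * conjc (z * z)).
Proof.
transitivity (normc (z * z) ^+ 2); first by rewrite ComplexField.Normc.normcM; ring.
case: (z * z) => a b /=; rewrite sqr_sqrtr ?addr_ge0 ?sqr_ge0 //.
by rewrite mulrN opprK.
Qed.

Lemma e2piD (s t : R) : e2pi (s + t) = e2pi s * e2pi t.
Proof.
apply/eqP; rewrite eq_complex /= !mulrDr cosD sinD.
by apply/andP; split; apply/eqP; ring.
Qed.

Lemma conjc_e2pi (t : R) : conjc (e2pi t) = e2pi (- t).
Proof. by rewrite /e2pi mulrN cosN sinN. Qed.

Lemma normc_e2pi (t : R) : normc (e2pi t) = 1.
Proof. by rewrite /= cos2Dsin2 sqrtr1. Qed.

Lemma dot3D (p q x : R * R * R) : dot3 (p + q) x = dot3 p x + dot3 q x.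
Proof. by rewrite /dot3 /=; ring. Qed.

Lemma dot3N (p x : R * R * R) : dot3 (- p) x = - dot3 p x.
Proof. by rewrite /dot3 /=; ring. Qed.

Definition quads (L : {fset R * R * R}) :=
  [seq (u, v) | u <- [seq (p, q) | p <- L, q <- L], v <- [seq (p, q) | p <- L, q <- L]].

Definition freq (w : (R * R * R) * (R * R * R) * ((R * R * R) * (R * R * R))) :=
  w.1.1 + w.1.2 - (w.2.1 + w.2.2).

Definition coef (a : R * R * R -> R[i])
    (w : (R * R * R) * (R * R * R) * ((R * R * R) * (R * R * R))) :=
  a w.1.1 * a w.1.2 * conjc (a w.2.1 * a w.2.2).

Lemma quadsP (L : {fset R * R * R}) w : w \in quads L ->
  [/\ w.1.1 \in L, w.1.2 \in L, w.2.1 \in L & w.2.2 \in L].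
Proof.
by move=> /allpairsP[[u v] [/allpairsP[[? ?] [? ? ->]] /allpairsP[[? ?] [? ? ->]] ->]].
Qed.

Lemma size_quads (L : {fset R * R * R}) : size (quads L) = (#|` L| ^ 4)%N.
Proof. by rewrite !size_allpairs; ring. Qed.

(** The fourth power is [F^2] times its conjugate, expanded over pairs of pairs. The minus sign
    comes from the real part of [z e(t)]. *)
Lemma normc_expsum4 (L : {fset R * R * R}) a x : normc (expsum L a x) ^+ 4 =
  \sum_(w <- quads L) trig R (complex.Re (coef a w)) (- complex.Im (coef a w)) (freq w) x.
Proof.
have F2 : expsum L a x * expsum L a x = \sum_(u <- [seq (p, q) | p <- L, q <- L])
    a u.1 * a u.2 * e2pi (dot3 (u.1 + u.2) x).
  rewrite big_allpairs /= /expsum big_distrl /=; apply: eq_bigr => p _.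
  rewrite big_distrr /=; apply: eq_bigr => q _.
  by rewrite dot3D e2piD mulrACA.
rewrite normc_exp4 F2 rmorph_sum /= big_distrl /= Re_sum [RHS]big_allpairs.
apply: eq_bigr => u _ /=; rewrite big_distrr /= Re_sum; apply: eq_bigr => v _.
rewrite (_ : conjc _ = conjc (a v.1 * a v.2) * e2pi (- dot3 (v.1 + v.2) x)); last first.
  by rewrite -conjc_e2pi; exact: (rmorphM (@conjc R)).
rewrite mulrACA -e2piD -dot3N -dot3D.
rewrite -/(freq (u, v)) -/(coef a (u, v)) /trig.
by case: (coef _ _) => c d /=; rewrite mulNr.
Qed.

Lemma normc_coef (L : {fset R * R * R}) a A w : (forall p, p \in L -> normc (a p) <= A) ->
  w \in quads L -> normc (coef a w) <= A ^+ 4.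
Proof.
move=> aA /quadsP[h1 h2 h3 h4].
rewrite /coef !ComplexField.Normc.normcM normc_conjc ComplexField.Normc.normcM.
rewrite (_ : A ^+ 4 = A * A * (A * A)); last by ring.
by apply: ler_pM; rewrite ?mulr_ge0 ?normc_ge0 //; apply: ler_pM; rewrite ?normc_ge0 ?aA.
Qed.

End FourthPower.

Section LevelBound.
Variable R : realType.
Implicit Types (c : R * R * R) (L : {fset R * R * R}) (a : R * R * R -> R[i]).
Local Notation side := (side R).
Local Notation box3 := (box3 R).
Local Notation freq := (freq R).
Local Notation quads := (quads R).
Local Notation coef := (coef R).

Lemma measurable_expsum4 L a :
  measurable_fun [set: measurableTypeR R * measurableTypeR R * measurableTypeR R]
    (fun x => normc (expsum L a x) ^+ 4).
Proof.
rewrite (_ : (fun x => _) = (fun x => \sum_(w <- quads L)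
   trig R (complex.Re (coef a w)) (- complex.Im (coef a w)) (freq w) x)).
  by apply: measurable_sum => w; exact: measurable_trig.
by apply/funext => x; exact: normc_expsum4.
Qed.

Definition energy L : R := \sum_(w <- quads L) (freq w == 0)%:R.

(** Each quadruple of frequency 0 contributes at most the volume times [A ^+ 4], any other one at
    most [2 * d * A ^+ 4], the 2 coming from the sum of the moduli of real and imaginary part. *)
Lemma integral_expsum4 L a (A d r : R) c : 0 < r -> 0 <= d ->
  (forall p, p \in L -> normc (a p) <= A) ->
  (forall w, w \in quads L -> freq w != 0 ->
     side r (freq w).1.1 * side r (freq w).1.2 * side r (freq w).2 <= d) ->
  exists2 V : R, (\int[@lebesgue3 R]_(x in box3 c r) (normc (expsum L a x) ^+ 4)%:E = V%:E)%E
   & V <= A ^+ 4 * ((2 * r) ^+ 3 * energy L + 2 * d * (#|` L|)%:R ^+ 4).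
Proof.
move=> r0 d0 aA sd.
have /choice[I Iw] w := integral_trig R (complex.Re (coef a w)) (- complex.Im (coef a w))
  (freq w) c r r0.
exists (\sum_(w <- quads L) I w).
  under eq_integral do rewrite normc_expsum4 -sumEFin.
  rewrite integral_sum.
  - by rewrite -sumEFin; apply: eq_bigr => w _; have [] := Iw w.
  - exact: measurable_box3.
  - by move=> w; exact: integrable_trig.
have -> : A ^+ 4 * ((2 * r) ^+ 3 * energy L + 2 * d * (#|` L|)%:R ^+ 4) =
    \sum_(w <- quads L) A ^+ 4 * ((2 * r) ^+ 3 * (freq w == 0)%:R + 2 * d).
  rewrite -big_distrr /= big_split /= -big_distrr /= big_const_seq count_predT iter_addr_0.
  by rewrite -[X in _ = _ * (_ + X)]mulr_natr size_quads natrX.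
rewrite big_seq [leRHS]big_seq; apply: ler_sum => w wL.
have cA := normc_coef _ _ _ _ _ aA wL.
have cR := le_trans (Re_le_normc _ _) cA; have cI := le_trans (Im_le_normc _ _) cA.
have A0 : 0 <= A ^+ 4 by apply: le_trans cA; exact: normc_ge0.
have [_ b z] := Iw w; have [f0|f0] := eqVneq (freq w) 0.
  rewrite (z f0) mulr1.
  have r3 : 0 <= (2 * r) ^+ 3 by rewrite exprn_ge0 // mulr_ge0 ?ltW.
  have h := ler_wpM2l r3 (le_trans (ler_norm _) cR).
  by apply: (le_trans h); rewrite mulrC ler_wpM2l // lerDl mulr_ge0.
rewrite mulr0 add0r; apply: (le_trans (ler_norm _)); apply: (le_trans b).
have -> : A ^+ 4 * (2 * d) = d * (2 * A ^+ 4) by ring.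
rewrite normrN; apply: ler_pM.
- by rewrite !mulr_ge0 ?side_ge0.
- by rewrite addr_ge0.
- exact: sd.
- by rewrite mulr_natl mulr2n lerD.
Qed.

End LevelBound.

(** * Additive energy of the paraboloid, and elementary estimates *)

Section Energy.
Variable R : realType.
Implicit Types (L : {fset R * R * R}).

(** Once [q = r + s - p] is eliminated, the third coordinates say that twice this inner product
    vanishes. *)
Lemma paraboloid_perp (p q r s : R * R * R) : paraboloid p -> paraboloid q ->
  paraboloid r -> paraboloid s -> p + q = r + s ->
  (r.1.1 - p.1.1) * (s.1.1 - p.1.1) + (r.1.2 - p.1.2) * (s.1.2 - p.1.2) = 0.
Proof.
case: p q r s => [[p1 p2] p3] [[q1 q2] q3] [[r1 r2] r3] [[s1 s2] s3].
move=> [_ _ /= ->] [_ _ /= ->] [_ _ /= ->] [_ _ /= ->] [e1 e2 e3].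
have {}e1 : q1 = r1 + s1 - p1 by rewrite -e1; ring.
have {}e2 : q2 = r2 + s2 - p2 by rewrite -e2; ring.
have : p1 ^+ 2 + p2 ^+ 2 + (q1 ^+ 2 + q2 ^+ 2) = r1 ^+ 2 + r2 ^+ 2 + (s1 ^+ 2 + s2 ^+ 2) by [].
rewrite e1 e2 => e.
have -> : (r1 - p1) * (s1 - p1) + (r2 - p2) * (s2 - p2) = 2^-1 *
  (p1 ^+ 2 + p2 ^+ 2 + ((r1 + s1 - p1) ^+ 2 + (r2 + s2 - p2) ^+ 2) -
   (r1 ^+ 2 + r2 ^+ 2 + (s1 ^+ 2 + s2 ^+ 2))) by field.
by rewrite e subrr mulr0.
Qed.

(** Dropping the third coordinate is injective on the paraboloid, and [p], [r], [s] determine [q],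
    so solutions inject into triples with a right angle at [p]. *)
Lemma energy_le L (J : nat) : [set` L] `<=` @paraboloid R -> (#|` L| <= 2 ^ J)%N ->
  energy R L <= 13824 * (#|` L|)%:R ^+ 2 * J.+1%:R.
Proof.
move=> Lpar NJ.
pose X (t : L) := (val t).1.1; pose Y (t : L) := (val t).1.2.
have injXY i j : X i = X j -> Y i = Y j -> i = j.
  rewrite /X /Y => x y; apply: val_inj.
  change (fsval i = fsval j); move: (Lpar _ (fsvalP i)) (Lpar _ (fsvalP j)) x y.
  change (val i) with (fsval i); change (val j) with (fsval j).
  case: (fsval i) => [[i1 i2] i3]; case: (fsval j) => [[j1 j2] j3].
  by move=> [_ _ /= ->] [_ _ /= ->] /= -> ->.
rewrite cardfE in NJ *.
have := count_perp R L X Y injXY J NJ; rewrite -(ler_nat R) => h.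
have -> : 13824 * #|{: L}|%:R ^+ 2 * J.+1%:R = (13824 * #|{: L}| ^ 2 * J.+1)%:R :> R.
  by rewrite 2!natrM natrX.
apply: le_trans h.
rewrite /energy /quads big_allpairs /=.
under eq_bigr do rewrite big_allpairs.
rewrite big_allpairs /= big_seq_fsetE /=.
under eq_bigr do rewrite exchange_big /= big_seq_fsetE /=.
rewrite natr_sum; apply: ler_sum => p _.
rewrite natr_sum; apply: ler_sum => r _.
rewrite exchange_big /= big_seq_fsetE natr_sum /=; apply: ler_sum => s _.
rewrite /freq /=; case: (boolP (perp R L X Y p r s)) => [_|np].
  case: (boolP (val r + val s - val p \in L)) => [qL|qL].
    rewrite (big_fsetD1 _ qL) /= big_seq big1 => [|q].
      by rewrite addr0 lern1 leq_b1.
    rewrite !inE => /andP[nq _]; case: eqP => // /subr0_eq e; case/negP: nq.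
    by rewrite -e addrAC subrr add0r.
  rewrite big_seq big1 // => q qL'; case: eqP => // /subr0_eq e; case/negP: qL.
  by rewrite -e addrAC subrr add0r.
rewrite big_seq big1 // => q qL; case: eqP => // /subr0_eq e; case/negP: np.
rewrite /perp; apply/eqP.
exact: (paraboloid_perp _ q _ _ (Lpar _ (fsvalP p)) (Lpar _ qL)
  (Lpar _ (fsvalP r)) (Lpar _ (fsvalP s)) e).
Qed.

End Energy.

(** * Oscillating terms at large radius *)

Section Eventually.
Variable R : realType.

Lemma eventually_all (I : eqType) (P : I -> R -> Prop) (s : seq I) :
  (forall w, exists2 R0, 0 < R0 & forall r, R0 <= r -> P w r) ->
  exists2 R0, 0 < R0 & forall r, R0 <= r -> forall w, w \in s -> P w r.
Proof.
move=> hP; elim: s => [|w s [R1 R10 h1]]; first by exists 1.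
have [R2 R20 h2] := hP w; exists (R1 + R2); first exact: addr_gt0.
move=> r rR w'; rewrite inE => /predU1P[->|ws]; first by apply: h2; lra.
by apply: h1 => //; lra.
Qed.

(** A nonzero coordinate of [eta] gives a factor bounded independently of [r]; the other two grow at
    most linearly. *)
Lemma side_eventually (d : R) (eta : R * R * R) : 0 < d -> exists2 R0, 0 < R0 &
  forall r, R0 <= r -> eta != 0 ->
    side R r eta.1.1 * side R r eta.1.2 * side R r eta.2 <= d * r ^+ 3.
Proof.
move=> d0; pose k x : R := 4 / `|2 * pi * x|.
have k0 x : 0 <= k x by rewrite divr_ge0.
have := (k0 eta.1.1, k0 eta.1.2, k0 eta.2) => -[[k1 k2] k3].
pose K := k eta.1.1 + k eta.1.2 + k eta.2.
have K0 : 0 <= K by rewrite !addr_ge0.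
have Kd : 0 <= 9 * K / d by rewrite divr_ge0 ?mulr_ge0 // ltW.
(* [K <= r] makes every side at most [3 * r], and [9 * K / d <= r] brings [K * (3 * r) * (3 * r)]
   below [d * r ^+ 3]. *)
exists (1 + K + 9 * K / d); first by lra.
move=> r rR eta0; move: Kd rR; set Kd := 9 * K / d => Kd0 rR.
have r0 : 0 < r by lra.
have rK : 9 * K <= d * r by rewrite [leRHS]mulrC -ler_pdivrMr // -/Kd; lra.
have s3 x : k x <= K -> side R r x <= 3 * r.
  have Kr : K <= r by lra.
  move=> kK; rewrite /side; case: ifP => _; first lra.
  by apply: (le_trans kK); lra.
have main x y z : x != 0 -> k x <= K -> k y <= K -> k z <= K ->
   side R r x * side R r y * side R r z <= d * r ^+ 3.
  move=> x0 kx ky kz.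
  have sx : side R r x <= K by rewrite /side (negbTE x0).
  apply: (@le_trans _ _ (K * (3 * r) * (3 * r))).
    apply: ler_pM; rewrite ?mulr_ge0 ?side_ge0 ?s3 //.
    by apply: ler_pM; rewrite ?side_ge0 ?s3.
  have -> : K * (3 * r) * (3 * r) = 9 * K * r ^+ 2 by ring.
  have -> : d * r ^+ 3 = d * r * r ^+ 2 by ring.
  by rewrite ler_wpM2r // sqr_ge0.
have h1 : k eta.1.1 <= K by rewrite /K; lra.
have h2 : k eta.1.2 <= K by rewrite /K; lra.
have h3 : k eta.2 <= K by rewrite /K; lra.
have [e1|e1] := eqVneq eta.1.1 0; last exact: main.
have [e2|e2] := eqVneq eta.1.2 0; last first.
  by rewrite (mulrC (side R r eta.1.1)); exact: main.
have e3 : eta.2 != 0.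
  apply: contraNneq eta0 => e3; apply/eqP.
  by rewrite [LHS]surjective_pairing [X in (X, _)]surjective_pairing e1 e2 e3.
by rewrite mulrC mulrA; exact: main.
Qed.

End Eventually.

(** * Balls compared with cubes *)

Section Ball.
Variable R : realType.
Local Notation R3 := (measurableTypeR R * measurableTypeR R * measurableTypeR R)%type.

Lemma eball3E (c : R * R * R) (r : R) : 0 < r ->
  eball3 c r = [set x | dot3 (x - c) (x - c) < r ^+ 2].
Proof.
move=> r0; apply/seteqP; split=> x /=; rewrite /eball3 /=.
  have d0 : 0 <= dot3 (x - c) (x - c) by rewrite /dot3 -!expr2 !addr_ge0 ?sqr_ge0.
  by move=> h; rewrite -(sqr_sqrtr d0) ltr_pXn2r ?nnegrE ?sqrtr_ge0 ?ltW.
by move=> h; rewrite -[ltRHS](@ger0_norm _ r) ?ltW // -sqrtr_sqr ltr_sqrt // exprn_gt0.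
Qed.

Lemma measurable_eball3 (c : R * R * R) (r : R) : 0 < r ->
  measurable (eball3 c r : set R3).
Proof.
move=> r0; rewrite eball3E //.
have m : measurable_fun [set: R3] (fun x : R3 => dot3 (x - c) (x - c)).
  have m1 : measurable_fun [set: R3] (fun x : R3 => x.1.1 - c.1.1).
    apply: measurable_funB; last exact: measurable_cst.
    by apply: measurableT_comp => //; exact: measurable_fst.
  have m2 : measurable_fun [set: R3] (fun x : R3 => x.1.2 - c.1.2).
    apply: measurable_funB; last exact: measurable_cst.
    by apply: measurableT_comp => //; exact: measurable_snd.
  have m3 : measurable_fun [set: R3] (fun x : R3 => x.2 - c.2).
    by apply: measurable_funB; [exact: measurable_snd | exact: measurable_cst].
  by apply: measurable_funD; first apply: measurable_funD; exact: measurable_funM.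
have := m measurableT [set` `]-oo, r ^+ 2[] (measurable_itv _).
by rewrite setTI; congr measurable; apply/seteqP; split=> x /=; rewrite in_itv.
Qed.

Lemma eball3_sub_box3 (c : R * R * R) (r : R) : 0 < r -> eball3 c r `<=` box3 R c r.
Proof.
move=> r0; rewrite eball3E // => -[[x1 x2] x3]; rewrite /dot3 /= => h.
have key (u v w : R) : u * u + v * v + w * w < r ^+ 2 -> - r <= u <= r.
  move=> huvw; rewrite -ler_norml -(@ler_pXn2r _ 2) ?nnegrE ?normr_ge0 ?(ltW r0) //.
  rewrite real_normK ?num_real //; have := sqr_ge0 v; have := sqr_ge0 w.
  by rewrite !expr2 in huvw *; lra.
have /andP[a1 b1] := key _ _ _ h.
have /andP[a2 b2] : - r <= x2 - c.1.2 <= r by apply: (key _ (x1 - c.1.1) (x3 - c.2)); lra.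
have /andP[a3 b3] : - r <= x3 - c.2 <= r by apply: (key _ (x1 - c.1.1) (x2 - c.1.2)); lra.
by split; [split|]; rewrite /= in_itv /=; apply/andP; split; lra.
Qed.

Lemma box3_sub_eball3 (c : R * R * R) (r : R) : 0 < r -> box3 R c (r / 2) `<=` eball3 c r.
Proof.
move=> r0; rewrite eball3E // => -[[x1 x2] x3] [[/=]]; rewrite !in_itv /=.
move=> /andP[a1 b1] /andP[a2 b2] /andP[a3 b3]; rewrite /dot3 /=.
have key (u : R) : - (r / 2) <= u -> u <= r / 2 -> u * u <= (r / 2) ^+ 2 by move=> ? ?; nra.
have h1 : (x1 - c.1.1) * (x1 - c.1.1) <= (r / 2) ^+ 2 by apply: key; lra.
have h2 : (x2 - c.1.2) * (x2 - c.1.2) <= (r / 2) ^+ 2 by apply: key; lra.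
have h3 : (x3 - c.2) * (x3 - c.2) <= (r / 2) ^+ 2 by apply: key; lra.
have : 0 < r ^+ 2 by rewrite exprn_gt0.
have -> : r ^+ 2 = 4 * (r / 2) ^+ 2 by field.
lra.
Qed.

(* The cube inscribed in the ball, of side [r], bounds its measure from below. *)
Lemma average_le_box (f : R3 -> R) (c : R * R * R) (r V : R) : 0 < r ->
  measurable_fun [set: R3] f -> (forall x, 0 <= f x) ->
  (\int[@lebesgue3 R]_(x in box3 R c r) (f x)%:E <= V%:E)%E ->
  ((@lebesgue3 R (eball3 c r))^-1 * \int[@lebesgue3 R]_(x in eball3 c r) (f x)%:E
   <= (V / r ^+ 3)%:E)%E.
Proof.
move=> r0 mf f0 fV; have mB := measurable_eball3 c r r0.
have hI : (\int[@lebesgue3 R]_(x in eball3 c r) (f x)%:E <= V%:E)%E.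
  apply: le_trans fV; apply: ge0_subset_integral => //.
  - exact: measurable_box3.
  - by apply/measurable_EFinP; apply: measurable_funTS.
  - by move=> x _; rewrite lee_fin.
  - exact: eball3_sub_box3.
have r3 : 0 < r ^+ 3 by rewrite exprn_gt0.
have hM : ((r ^+ 3)%:E <= @lebesgue3 R (eball3 c r))%E.
  have <- : @lebesgue3 R (box3 R c (r / 2)) = (r ^+ 3)%:E.
    by rewrite lebesgue3_box3 ?divr_gt0 //; congr EFin; field.
  apply: le_measure; rewrite ?inE; [exact: measurable_box3 | exact: mB |].
  exact: box3_sub_eball3.
rewrite mulrC EFinM; apply: lee_pmul => //.
- by rewrite inve_ge0.
- by apply: integral_ge0 => x _; rewrite lee_fin.
have -> : ((r ^+ 3)^-1%:E = (r ^+ 3)%:E^-1 :> \bar R)%E by rewrite inver gt_eqF.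
by rewrite lee_pV2 // inE ?lee_fin ?(ltW r3) ?measure_ge0.
Qed.

End Ball.

Section PowerMean.
Variable R : realType.

Lemma sqr_sum_le (n : nat) (x : 'I_n -> R) :
  (\sum_i x i) ^+ 2 <= n%:R * \sum_i x i ^+ 2.
Proof.
have cst (y : R) : \sum_(j < n) y = n%:R * y by rewrite sumr_const card_ord mulr_natl.
have : 0 <= \sum_i \sum_j (x i - x j) ^+ 2.
  by apply: sumr_ge0 => i _; apply: sumr_ge0 => j _; exact: sqr_ge0.
have -> : \sum_i \sum_j (x i - x j) ^+ 2 =
    2 * (n%:R * \sum_i x i ^+ 2) - 2 * (\sum_i x i) ^+ 2.
  transitivity (\sum_i (n%:R * x i ^+ 2 - 2 * x i * (\sum_j x j) + \sum_j x j ^+ 2)).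
    apply: eq_bigr => i _.
    rewrite (eq_bigr (fun j => x i ^+ 2 - 2 * x i * x j + x j ^+ 2)); last by move=> j _; ring.
    by rewrite big_split sumrB /= cst -big_distrr.
  rewrite big_split sumrB /= cst -big_distrl -!big_distrr /=.
  ring.
lra.
Qed.

(** Cauchy-Schwarz twice. With [n] the number of dyadic pieces, the cube is only a power of a
    logarithm. *)
Lemma exp4_sum_le (n : nat) (x : 'I_n -> R) :
  (\sum_i x i) ^+ 4 <= n%:R ^+ 3 * \sum_i x i ^+ 4.
Proof.
have h1 := sqr_sum_le _ x; have h2 := sqr_sum_le _ (fun i => x i ^+ 2).
have -> : (\sum_i x i) ^+ 4 = ((\sum_i x i) ^+ 2) ^+ 2 by rewrite -exprM.
apply: (@le_trans _ _ ((n%:R * \sum_i x i ^+ 2) ^+ 2)).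
  by rewrite ler_pXn2r ?nnegrE ?sqr_ge0 // (le_trans _ h1) ?sqr_ge0.
rewrite exprMn [n%:R ^+ 3]exprSr -mulrA ler_wpM2l ?exprn_ge0 //.
by apply: (le_trans h2); under eq_bigr do rewrite -exprM.
Qed.

End PowerMean.

(** * Dyadic decomposition of the coefficients *)

Section Dyadic.
Variable R : realType.

Definition dyadic_level (A x : R) (j : nat) : bool := A / 2 ^+ j.+1 < x <= A / 2 ^+ j.

(** The target [V] is general because the splitting serves both the exponential sum, in [R[i]], and
    the sums of squares, in [R]. *)
Lemma dyadic_split (V : nmodType) (I : Type) (s : seq I) (g : I -> V) (h : I -> R)
    (A : R) (J : nat) : 0 <= A ->
  \sum_(p <- s | h p <= A) g p =
  \sum_(j < J) \sum_(p <- s | dyadic_level A (h p) j) g p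
    + \sum_(p <- s | h p <= A / 2 ^+ J) g p.
Proof.
move=> A0; elim: J => [|J IH]; first by rewrite big_ord0 add0r expr0 divr1.
rewrite big_ord_recr /= -addrA IH; congr (_ + _).
rewrite (bigID (fun p => A / 2 ^+ J.+1 < h p)) /=; congr (_ + _).
  by apply: eq_bigl => p; rewrite /dyadic_level andbC.
apply: eq_bigl => p; rewrite -leNgt andbC; case: leP => //= hp.
apply: (le_trans hp); rewrite ler_wpM2l // lef_pV2 ?posrE ?exprn_gt0 //.
by rewrite ler_eXn2l ?ltr1n.
Qed.

(** In the power 4 of [J.+1], three factors come from the power mean over the pieces and one from
    the energy. *)
Lemma box_bound : exists2 M : R, 1 <= M &
  forall (L : {fset R * R * R}) (J : nat), [set` L] `<=` @paraboloid R ->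
  (#|` L| <= 2 ^ J)%N -> exists2 R0 : R, 0 < R0 & forall r c a, R0 <= r ->
  (\int[@lebesgue3 R]_(x in box3 R c r) (normc (expsum L a x) ^+ 4)%:E
    <= (M * J.+1%:R ^+ 4 * (\sum_(xi <- L) normc (a xi) ^+ 2) ^+ 2 * r ^+ 3)%:E)%E.
Proof.
have [K K1 HK] : exists2 K : R, 1 <= K & forall (L : {fset R * R * R}) (J : nat),
    [set` L] `<=` @paraboloid R -> (#|` L| <= 2 ^ J)%N ->
    energy R L <= K * (#|` L|)%:R ^+ 2 * J.+1%:R.
  by exists 13824; [rewrite ler1n | exact: energy_le].
(* This is [16 * (8 * K + 1)] from the levels plus 8 from the tail, the latter through
   [(2 * r) ^+ 3]. *)
exists (128 * K + 24); first lra.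
move=> L J Lpar NJ; set N := #|` L| in NJ *.
(* Small enough for the off-diagonal terms of a level with [Nj] points to total at most
   [r ^+ 3 * Nj ^+ 2]; [N.+1] avoids dividing by zero when [L] is empty. *)
pose d : R := (2 * N.+1%:R ^+ 2)^-1.
have d0 : 0 < d by rewrite invr_gt0 mulr_gt0 // exprn_gt0.
have [R0 R00 hR0] := @eventually_all R _ _ (quads R L)
  (fun w => side_eventually R d (freq R w) d0).
exists R0 => // r c a rR; have r0 : 0 < r := lt_le_trans R00 rR.
have r30 : 0 < r ^+ 3 by rewrite exprn_gt0.
have {}hR0 := hR0 r rR.
set S := \sum_(xi <- L) _; pose A := Num.sqrt S.
have S0 : 0 <= S by apply: sumr_ge0 => p _; rewrite sqr_ge0.
have A0 : 0 <= A := sqrtr_ge0 _.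
have A2 : A ^+ 2 = S by rewrite sqr_sqrtr.
have aA p : p \in L -> normc (a p) <= A.
  move=> pL; rewrite -(@ler_pXn2r _ 2) ?nnegrE ?normc_ge0 // A2 /S.
  by rewrite (big_fsetD1 _ pL) /= lerDl sumr_ge0 // => q _; rewrite sqr_ge0.
have split_all (V : nmodType) (g : R * R * R -> V) : \sum_(p <- L) g p =
    \sum_(j < J) \sum_(p <- L | dyadic_level A (normc (a p)) j) g p
    + \sum_(p <- L | normc (a p) <= A / 2 ^+ J) g p.
  rewrite -dyadic_split // big_seq [RHS]big_seq_cond; apply: eq_bigl => p.
  by case: (boolP (p \in L)) => //= /aA ->.
pose Lj j := [fset p in L | dyadic_level A (normc (a p)) j]%fset.
have sumLj (V : nmodType) (g : R * R * R -> V) j : \sum_(p <- Lj j) g p =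
    \sum_(p <- L | dyadic_level A (normc (a p)) j) g p by rewrite big_fset.
have LjP j p : p \in Lj j -> p \in L /\ dyadic_level A (normc (a p)) j.
  by rewrite !inE => /andP[].
have LjL j : (Lj j `<=` L)%fset by apply/fsubsetP => p /LjP[].
have NjN j : (#|` Lj j| <= N)%N by apply: fsubset_leq_card.
have dr0 : 0 <= d * r ^+ 3 by rewrite mulr_ge0 ?ltW.
have qsub j w : w \in quads R (Lj j) -> w \in quads R L.
  case: w => [[p q] [s t]] /quadsP[/= /LjP[p1 _] /LjP[q1 _] /LjP[s1 _] /LjP[t1 _]].
  by apply: allpairs_f; apply: allpairs_f.
have level j := @integral_expsum4 R (Lj j) a (A / 2 ^+ j) (d * r ^+ 3) r c r0 dr0
  (fun p pj => proj2 (andP (proj2 (LjP j p pj))))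
  (fun w wL => hR0 w (qsub j w wL)).
have /choice[V hV] (j : 'I_J) : exists V : R,
    (\int[@lebesgue3 R]_(x in box3 R c r) (normc (expsum (Lj j) a x) ^+ 4)%:E = V%:E)%E /\
    V <= 16 * (8 * K + 1) * J.+1%:R * r ^+ 3 * S *
      \sum_(p <- L | dyadic_level A (normc (a p)) j) normc (a p) ^+ 2.
  have [V eV leV] := level j.
  exists V; split=> //; apply: (le_trans leV); rewrite -sumLj.
  set sj := \sum_(p <- Lj j) _; set Nj : R := (#|` Lj j|)%:R.
  set B := A / 2 ^+ j.
  have B0 : 0 <= B by rewrite divr_ge0 ?exprn_ge0.
  have sj0 : 0 <= sj by apply: sumr_ge0 => p _; rewrite sqr_ge0.
  have sjS : sj <= S.
    rewrite /S split_all (bigD1 j) //= -sumLj -addrA lerDl addr_ge0 //.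
      by apply: sumr_ge0 => i _; apply: sumr_ge0 => p _; rewrite sqr_ge0.
    by apply: sumr_ge0 => p _; rewrite sqr_ge0.
  (* Coefficients of this level exceed [B / 2]. Thus [B ^+ 4 * Nj ^+ 2] is at most
     [16 * sj ^+ 2 <= 16 * (S * sj)], which sums over the levels to a multiple of [S ^+ 2]. *)
  have BN : B ^+ 2 * Nj <= 4 * sj.
    have -> : B ^+ 2 * Nj = \sum_(p <- Lj j) B ^+ 2.
      by rewrite big_const_seq count_predT iter_addr_0 mulr_natr.
    rewrite /sj big_distrr /= big_seq [leRHS]big_seq; apply: ler_sum => p /LjP[_ /andP[pl _]].
    have -> : 4 * normc (a p) ^+ 2 = (2 * normc (a p)) ^+ 2 by ring.
    rewrite ler_pXn2r ?nnegrE ?mulr_ge0 ?normc_ge0 //.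
    by move: pl; rewrite exprS invfM mulrCA -/B; lra.
  have J1 : 1 <= J.+1%:R :> R by rewrite ler1n.
  have Nj0 : 0 <= Nj by [].
  have NjN' : Nj ^+ 2 * (2 * d) <= 1.
    have -> : 2 * d = (N.+1%:R ^+ 2)^-1 by rewrite /d invfM mulrA divff ?mul1r.
    rewrite ler_pdivrMr ?exprn_gt0 // mul1r.
    by rewrite ler_pXn2r ?nnegrE // ler_nat ltnW // ltnS.
  have E := HK (Lj j) J (fun p pj => Lpar p (proj1 (LjP j p pj))) (leq_trans (NjN j) NJ).
  rewrite -/Nj in E *.
  have E' : (2 * r) ^+ 3 * energy R (Lj j) + 2 * (d * r ^+ 3) * Nj ^+ 4
     <= r ^+ 3 * Nj ^+ 2 * ((8 * K + 1) * J.+1%:R).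
    have e1 : (2 * r) ^+ 3 * energy R (Lj j) <= r ^+ 3 * Nj ^+ 2 * (8 * K * J.+1%:R).
      have -> : r ^+ 3 * Nj ^+ 2 * (8 * K * J.+1%:R) =
        (2 * r) ^+ 3 * (K * Nj ^+ 2 * J.+1%:R) by ring.
      by rewrite ler_wpM2l // exprn_ge0 // mulr_ge0 // ltW.
    have e2 : 2 * (d * r ^+ 3) * Nj ^+ 4 <= r ^+ 3 * Nj ^+ 2 * J.+1%:R.
      have -> : 2 * (d * r ^+ 3) * Nj ^+ 4 = r ^+ 3 * Nj ^+ 2 * (Nj ^+ 2 * (2 * d)) by ring.
      apply: ler_wpM2l; first by rewrite mulr_ge0 ?sqr_ge0 // ltW.
      exact: le_trans NjN' J1.
    by apply: (le_trans (lerD e1 e2)); rewrite le_eqVlt; apply/orP; left; apply/eqP; ring.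
  apply: (@le_trans _ _ (B ^+ 4 * (r ^+ 3 * Nj ^+ 2 * ((8 * K + 1) * J.+1%:R)))).
    by rewrite ler_wpM2l // exprn_ge0.
  have -> : B ^+ 4 * (r ^+ 3 * Nj ^+ 2 * ((8 * K + 1) * J.+1%:R)) =
    (8 * K + 1) * J.+1%:R * r ^+ 3 * (B ^+ 2 * Nj) ^+ 2 by ring.
  have -> : 16 * (8 * K + 1) * J.+1%:R * r ^+ 3 * S * sj =
    (8 * K + 1) * J.+1%:R * r ^+ 3 * (16 * (S * sj)) by ring.
  have K0 : 0 <= 8 * K + 1 by lra.
  apply: ler_wpM2l; first by rewrite !mulr_ge0 // ltW.
  apply: (@le_trans _ _ ((4 * sj) ^+ 2)).
    by rewrite ler_pXn2r ?nnegrE ?mulr_ge0 ?sqr_ge0.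
  have -> : (4 * sj) ^+ 2 = 16 * (sj * sj) by ring.
  by rewrite ler_wpM2l // ler_wpM2r.
(* The coefficients below [A / 2 ^+ J] add up to at most [N * A / 2 ^+ J <= A]; they form one extra
   piece, whence [J.+1]. *)
have F4 x : normc (expsum L a x) ^+ 4 <=
    J.+1%:R ^+ 3 * (\sum_(j < J) normc (expsum (Lj j) a x) ^+ 4 + A ^+ 4).
  pose y (i : 'I_J.+1) := if (i < J)%N then normc (expsum (Lj i) a x) else A.
  have := exp4_sum_le R _ y; rewrite !big_ord_recr /= /y /= ltnn.
  under eq_bigr do rewrite ltn_ord.
  under [X in _ <= _ * (X + _) -> _]eq_bigr do rewrite ltn_ord.
  apply: le_trans; rewrite ler_pXn2r ?nnegrE ?normc_ge0 //; last first.
    by rewrite addr_ge0 // sumr_ge0 // => j _; exact: normc_ge0.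
  rewrite [expsum L a x]split_all; apply: (le_trans (le_normcD _ _)); apply: lerD.
    by apply: (le_trans (normc_sum _ _ _ _ _)); apply: ler_sum => j _; rewrite /expsum sumLj.
  apply: (le_trans (normc_sum _ _ _ _ _)).
  apply: (@le_trans _ _ (\sum_(p <- L | normc (a p) <= A / 2 ^+ J) A / 2 ^+ J)).
    by apply: ler_sum => p h; rewrite ComplexField.Normc.normcM normc_e2pi mulr1.
  apply: (@le_trans _ _ (\sum_(p <- L) A / 2 ^+ J)).
    rewrite big_mkcond /=; apply: ler_sum => p _; case: ifP => // _.
    by rewrite divr_ge0 ?exprn_ge0.
  rewrite big_const_seq count_predT iter_addr_0 -[leLHS]mulr_natl mulrCA ler_piMr //.
  by rewrite ler_pdivrMr ?exprn_gt0 // mul1r -natrX ler_nat.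
pose G x := J.+1%:R ^+ 3 * (\sum_(j < J) normc (expsum (Lj j) a x) ^+ 4 + A ^+ 4).
have mS := fun j => measurable_expsum4 R (Lj j) a.
have mB := measurable_box3 R c r.
have IG : (\int[@lebesgue3 R]_(x in box3 R c r) (G x)%:E =
   (J.+1%:R ^+ 3 * (\sum_(j < J) V j + A ^+ 4 * (2 * r) ^+ 3))%:E)%E.
  have mf (j : 'I_J) : measurable_fun (box3 R c r)
      (fun x => (normc (expsum (Lj j) a x) ^+ 4)%:E).
    by apply/measurable_EFinP; apply: measurable_funTS; exact: mS.
  have f0 (j : 'I_J) x : box3 R c r x -> (0 <= (normc (expsum (Lj j) a x) ^+ 4)%:E)%E.
    by move=> _; rewrite lee_fin exprn_ge0 ?normc_ge0.
  have msum := emeasurable_sum (index_enum 'I_J) mf.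
  have sum0 x : box3 R c r x ->
      (0 <= \sum_(j < J) (normc (expsum (Lj j) a x) ^+ 4)%:E)%E.
    by move=> xB; apply: sume_ge0 => j _; exact: f0.
  have A40 x : box3 R c r x -> (0 <= (A ^+ 4)%:E)%E by rewrite lee_fin exprn_ge0.
  have mA : measurable_fun (box3 R c r) (fun _ => (A ^+ 4)%:E) := measurable_cst _.
  under eq_integral do rewrite /G EFinM EFinD -sumEFin.
  rewrite (@ge0_integralZl _ _ _ (@lebesgue3 R) _ mB _ (emeasurable_funD msum mA)); first last.
  - by rewrite lee_fin exprn_ge0.
  - by move=> x xB; rewrite adde_ge0 // ?sum0 // (A40 x).
  rewrite (@ge0_integralD _ _ _ (@lebesgue3 R) _ mB _ _ sum0 msum A40 mA).
  rewrite (@ge0_integral_sum _ _ _ (@lebesgue3 R) _ mB _ _ mf f0).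
  rewrite integral_cst // lebesgue3_box3 //.
  rewrite (eq_bigr (fun j => (V j)%:E)); last by move=> j _; exact: (hV j).1.
  by rewrite sumEFin -EFinM.
apply: (@le_trans _ _ (\int[@lebesgue3 R]_(x in box3 R c r) (G x)%:E)%E).
  apply: ge0_le_integral => //.
  - by move=> x _; rewrite lee_fin exprn_ge0 ?normc_ge0.
  - by apply/measurable_EFinP; apply: measurable_funTS; exact: measurable_expsum4.
  - apply/measurable_EFinP; apply: measurable_funTS.
    apply: measurable_funM; first exact: measurable_cst.
    apply: measurable_funD; last exact: measurable_cst.
    by apply: measurable_sum => j; exact: mS.
  - by move=> x _; rewrite lee_fin; exact: F4.
rewrite IG lee_fin.
have J1 : 1 <= J.+1%:R :> R by rewrite ler1n.
have sV : \sum_(j < J) V j <= 16 * (8 * K + 1) * J.+1%:R * r ^+ 3 * S * S.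
  apply: (@le_trans _ _ (\sum_(j < J) 16 * (8 * K + 1) * J.+1%:R * r ^+ 3 * S *
      \sum_(p <- L | dyadic_level A (normc (a p)) j) normc (a p) ^+ 2)).
    by apply: ler_sum => j _; exact: (hV j).2.
  have K0 : 0 <= 8 * K + 1 by lra.
  rewrite -big_distrr /=; apply: ler_wpM2l; first by rewrite !mulr_ge0 // ltW.
  by rewrite [leRHS]split_all lerDl sumr_ge0 // => p _; rewrite sqr_ge0.
have -> : (128 * K + 24) * J.+1%:R ^+ 4 * S ^+ 2 * r ^+ 3 = J.+1%:R ^+ 3 *
  (16 * (8 * K + 1) * J.+1%:R * r ^+ 3 * S * S + 8 * J.+1%:R * r ^+ 3 * S ^+ 2) by ring.
rewrite ler_wpM2l ?exprn_ge0 //; apply: lerD => //.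
have -> : A ^+ 4 * (2 * r) ^+ 3 = 8 * r ^+ 3 * S ^+ 2 by rewrite -A2; ring.
by rewrite ler_wpM2r ?sqr_ge0 // ler_wpM2r ?(ltW r30) // ler_peMr.
Qed.

End Dyadic.

(** From [exp x >= 1 + x] at [x = t * (eps * ln 2)]. *)
Lemma log_le_powR (R : realType) (eps : R) (t N : nat) : 0 < eps -> (2 ^ t <= N)%N ->
  t.+2%:R <= (2 + (eps * ln 2)^-1) * N%:R `^ eps.
Proof.
move=> e0 tN; have l0 : 0 < ln (2 : R) by rewrite ln_gt0 // ltr1n.
have el : 0 < eps * ln 2 by rewrite mulr_gt0.
have h : 1 + t%:R * (eps * ln 2) <= N%:R `^ eps.
  apply: (@le_trans _ _ ((2 ^+ t : R) `^ eps)).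
    rewrite /powR gt_eqF ?exprn_gt0 // lnXn // -[ln 2 *+ t]mulr_natl [eps * (_ * _)]mulrCA.
    exact: expR_ge1Dx.
  apply: ge0_ler_powR; rewrite ?nnegrE ?exprn_ge0 //; first exact: ltW.
  by rewrite -natrX ler_nat.
apply: le_trans (ler_wpM2l _ h); last by rewrite addr_ge0 // invr_ge0 ltW.
have -> : (2 + (eps * ln 2)^-1) * (1 + t%:R * (eps * ln 2)) =
  2 + (eps * ln 2)^-1 + 2 * (t%:R * (eps * ln 2)) + t%:R by field; lra.
have : 0 <= (eps * ln 2)^-1 by rewrite invr_ge0 ltW.
have : 0 <= t%:R * (eps * ln 2) by rewrite mulr_ge0 // ltW.
by rewrite -!natr1; lra.
Qed.

Theorem theorem2p5 (R : realType) (eps : R) :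
  0 < eps ->
  exists C : R,
  forall L : {fset R * R * R}, [set` L] `<=` @paraboloid R ->
  exists R0 : R, 0 < R0 /\
  forall (r : R) (c : R * R * R) (a : R * R * R -> R[i]), R0 <= r ->
  (poweR ((@lebesgue3 R (eball3 c r))^-1 *
     \int[@lebesgue3 R]_(x in eball3 c r)
        ((ComplexField.Normc.normc (expsum L a x) ^+ 4)%:E)) (4^-1)
   <= (C * (#|` L|)%:R `^ eps *
        Num.sqrt (\sum_(xi <- L) ComplexField.Normc.normc (a xi) ^+ 2))%:E)%E.
Proof.
move=> eps0; have [M M1 HM] := box_bound R.
exists (M * (2 + (eps * ln 2)^-1)) => L Lpar.
set N := #|` L|; pose t := trunc_log 2 N.
have NJ : (N <= 2 ^ t.+1)%N by apply: ltnW; exact: trunc_log_ltn.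
have [R0 R00 hR0] := HM L t.+1 Lpar NJ.
exists R0; split=> // r c a rR; have r0 : 0 < r := lt_le_trans R00 rR.
set S := \sum_(xi <- L) _.
have S0 : 0 <= S by apply: sumr_ge0 => p _; rewrite sqr_ge0.
have r30 : r ^+ 3 != 0 by rewrite expf_neq0 // gt_eqF.
have avg := average_le_box R _ c r _ r0 (measurable_expsum4 R L a)
  (fun x => exprn_ge0 4 (normc_ge0 R _)) (hR0 r c a rR).
rewrite mulfK // in avg.
(* Since [1 <= M], [M <= M ^+ 4], so [M] can be kept as it is when the fourth root is taken. *)
pose Z := M * t.+2%:R * Num.sqrt S.
have M0 : 0 <= M by lra.
have Z0 : 0 <= Z by rewrite !mulr_ge0.
have ZM : M * t.+2%:R ^+ 4 * S ^+ 2 <= Z ^+ 4.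
  have -> : Z ^+ 4 = M ^+ 4 * t.+2%:R ^+ 4 * (Num.sqrt S ^+ 2) ^+ 2 by rewrite /Z; ring.
  rewrite sqr_sqrtr // ler_wpM2r ?sqr_ge0 // ler_wpM2r ?exprn_ge0 //.
  by rewrite ler_eXnr.
have avg' := le_trans avg (_ : (_ <= (Z ^+ 4)%:E)%E); rewrite lee_fin in avg'.
have {}avg' := avg' ZM.
apply: (@le_trans _ _ Z%:E).
  have -> : Z%:E = poweR (Z ^+ 4)%:E 4^-1.
    by rewrite poweR_EFin -powR_mulrn // -powRrM divff // powRr1.
  apply: gt0_ler_poweR => //; rewrite in_itv /= ?leey ?andbT ?lee_fin ?exprn_ge0 //.
  rewrite mule_ge0 ?inve_ge0 //; apply: integral_ge0 => x _.
  by rewrite lee_fin exprn_ge0 ?normc_ge0.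
rewrite lee_fin /Z.
(* [2 ^ t <= N] fails for the empty set, where both sides are 0. *)
have [N0|N0] := posnP N.
  have -> : S = 0.
    by rewrite /S; move/eqP: N0; rewrite cardfs_eq0 => /eqP ->; rewrite big_seq_fset0.
  by rewrite sqrtr0 !mulr0.
rewrite ler_wpM2r ?sqrtr_ge0 // -mulrA ler_wpM2l // log_le_powR //.
exact: trunc_logP.
Qed.
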